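(* Let $d\ge2$ and let $\mathcal M\subset\mathbb S^{d-1}$ satisfy: (i) $\mathcal M$ is connected, relatively open in $\mathbb S^{d-1}$, and $\overline{\mathcal M}\ne\mathbb S^{d-1}$; (ii) $\inf_{p\in\partial_{\mathbb S}\mathcal M,\,r\in(0,1]}r^{-(d-1)}A_{\mathbb S}(\{\sigma\in\mathbb S^{d-1}\setminus\mathcal M:|\sigma-p|<r\})>0$; (iii) there are $A,N>0$ with $w_0(\sigma)\ge N^{-1}\mathrm{dist}(\sigma,\partial_{\mathbb S}\mathcal M)^A$ for all $\sigma\in\mathcal M$. Let $\Omega=\{x\in\mathbb R^d\setminus\{0\}:x/|x|\in\mathcal M\}$. Suppose $u\in C^\infty(Q_1^\Omega)$ satisfies $u_t=\Delta u$ in $Q_1^\Omega$ and $\lim_{(t,x)\to(t_0,x_0)}u(t,x)=0$ whenever $0<t_0\le1$ and $x_0\in\partial\Omega\cap B_1$. Then for any $\epsilon\in(0,1)$ and $R\in(0,1)$, $$|u(t,x)|\le N\Big(\sup_{Q_1^\Omega}|u|\Big)W_0(x)^{1-\epsilon}\quad\text{for all }(t,x)\in Q_R^\Omega,$$ where $N=N(\mathcal M,\epsilon,R)>0$.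
   Context: $A_{\mathbb S}$ is surface measure on $\mathbb S^{d-1}$, $\partial_{\mathbb S}\mathcal M=\overline{\mathcal M}\setminus\mathcal M$. For $f$ on $\mathcal M$ let $F_f(x)=f(x/|x|)$; $f\in C^\infty(\mathcal M)$ means $F_f\in C^\infty(\Omega)$, and $\nabla_{\mathbb S}f:=\nabla F_f|_{\mathcal M}$, $\Delta_{\mathbb S}f:=\Delta F_f|_{\mathcal M}$. $\mathring W^1_2(\mathcal M)$ is the closure of $C_c^\infty(\mathcal M)$ under $\|f\|_{L_2(\mathcal M)}+\|\nabla_{\mathbb S}f\|_{L_2(\mathcal M)}$. Under (i), $\Lambda_0:=\inf_{w\in C_c^\infty(\mathcal M),w\ne0}\int_{\mathcal M}|\nabla_{\mathbb S}w|^2dA_{\mathbb S}/\int_{\mathcal M}|w|^2dA_{\mathbb S}>0$ and there is a unique $w_0\in C^\infty(\mathcal M)\cap\mathring W^1_2(\mathcal M)$ with $w_0>0$, $\int_{\mathcal M}w_0^2dA_{\mathbb S}=1$, $\Delta_{\mathbb S}w_0+\Lambda_0w_0=0$ (the first Dirichlet eigenfunction); this is the $w_0$ in (iii). $\lambda_0:=-\frac{d-2}{2}+\sqrt{\Lambda_0+(\frac{d-2}{2})^2}$ and $W_0(x):=|x|^{\lambda_0}w_0(x/|x|)$. $B_R=B_R(0)$, $B_R^\Omega=\Omega\cap B_R(0)$, $Q_R^\Omega=(1-R^2,1]\times B_R^\Omega$. *)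

(* Defs.v *)
From mathcomp Require Import all_boot all_order all_algebra.
From mathcomp Require Import all_classical all_reals all_analysis.
Set Implicit Arguments. Unset Strict Implicit. Unset Printing Implicit Defensive.
Import Order.TTheory GRing.Theory Num.Theory.
Import numFieldNormedType.Exports.
Local Open Scope classical_set_scope.
Local Open Scope ring_scope.

Section Defs.
Variables (R : realType) (d : nat).
Local Notation V := 'rV[R]_d.
Local Notation PT := (R * 'rV[R]_d)%type.

(* Euclidean norm |x| on R^d (the library norm on 'rV is the sup norm). *)
Definition enorm (x : V) : R := Num.sqrt (\sum_(i < d) x ord0 i ^+ 2).

Definition sphere : set V := [set x | enorm x = 1].

Definition rproj (x : V) : V := (enorm x)^-1 *: x.

Definition Fext (f : V -> R) : V -> R := fun x => f (rproj x).

Definition cone (M : set V) : set V := [set x | x != 0 /\ M (rproj x)].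

Definition sbdry (M : set V) : set V := closure M `\` M.

Definition sdist (x : V) (A : set V) : R := inf [set enorm (x - p) | p in A].

Definition eball (r : R) : set V := [set x | enorm x < r].

Fixpoint iterDir {W : normedModType R} (vs : seq W) (f : W -> R) : W -> R :=
  match vs with
  | [::] => f
  | v :: vs' => 'D_v (iterDir vs' f)
  end.

Definition smooth_on {W : normedModType R} (D : set W) (f : W -> R) : Prop :=
  forall vs : seq W, forall x, D x ->
    (forall v, derivable (iterDir vs f) x v) /\ {for x, continuous (iterDir vs f)}.

Definition ev (i : 'I_d) : V := delta_mx 0 i.

Definition grad2S (f : V -> R) (x : V) : R :=
  \sum_(i < d) ('D_(ev i) (Fext f) x) ^+ 2.
Definition lapS (f : V -> R) (x : V) : R :=
  \sum_(i < d) 'D_(ev i) ('D_(ev i) (Fext f)) x.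

Definition box (a b : V) : set V :=
  [set x | forall i, a ord0 i <= x ord0 i <= b ord0 i].
Definition boxvol (a b : V) : R := \prod_(i < d) Num.max (b ord0 i - a ord0 i) 0.
Definition leb_outer (A : set V) : \bar R :=
  ereal_inf [set (\sum_(0 <= k <oo) (boxvol (ab.1 k) (ab.2 k))%:E)%E
            | ab in [set ab : (nat -> V) * (nat -> V) |
                      A `<=` \bigcup_k box (ab.1 k) (ab.2 k)]].

Definition surf (E : set V) : \bar R :=
  ((d%:R)%:E * leb_outer [set x | (0 < enorm x < 1)%R /\ E (rproj x)])%E.

(* integral over E of a nonnegative function g w.r.t. A_S (layer-cake formula) *)
Definition surf_int (E : set V) (g : V -> R) : \bar R :=
  (\int[@lebesgue_measure R]_(s in `]0%R, +oo[) surf [set x | E x /\ (s < g x)%R])%E.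

Definition Cc_smooth (M : set V) (w : V -> R) : Prop :=
  smooth_on (cone M) (Fext w) /\
  compact (closure [set x | M x /\ w x != 0]) /\
  closure [set x | M x /\ w x != 0] `<=` M.

Definition Lambda0 (M : set V) : R :=
  inf [set fine (surf_int M (grad2S w)) / fine (surf_int M (fun x => w x ^+ 2))
      | w in [set w | Cc_smooth M w /\ exists2 x, M x & w x != 0]].

Definition in_W12o (M : set V) (f : V -> R) : Prop :=
  exists phi : nat -> V -> R, (forall n, Cc_smooth M (phi n)) /\
    (surf_int M (fun x => (phi n x - f x) ^+ 2) @[n --> \oo] --> 0%E) /\
    (surf_int M (grad2S (fun x => phi n x - f x)) @[n --> \oo] --> 0%E).

Definition first_dirichlet_eigenfunction (M : set V) (w0 : V -> R) : Prop :=
  smooth_on (cone M) (Fext w0) /\ in_W12o M w0 /\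
  (forall x, M x -> 0 < w0 x) /\
  surf_int M (fun x => w0 x ^+ 2) = 1%E /\
  (forall x, M x -> lapS w0 x + Lambda0 M * w0 x = 0).

Definition lambda0 (M : set V) : R :=
  - ((d%:R - 2) / 2) + Num.sqrt (Lambda0 M + ((d%:R - 2) / 2) ^+ 2).

Definition W0 (M : set V) (w0 : V -> R) (x : V) : R :=
  powR (enorm x) (lambda0 M) * w0 (rproj x).

Definition Qcyl (M : set V) (r : R) : set PT :=
  [set z | 1 - r ^+ 2 < z.1 <= 1 /\ cone M z.2 /\ enorm z.2 < r].

Definition dt (u : PT -> R) : PT -> R := 'D_((1, 0) : PT) u.
Definition lapx (u : PT -> R) (z : PT) : R :=
  \sum_(i < d) 'D_((0, ev i) : PT) ('D_((0, ev i) : PT) u) z.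

Definition smooth_upto (Q : set PT) (u : PT -> R) : Prop :=
  exists G : set PT, open G /\ Q `<=` G /\ smooth_on G u.

End Defs.

(* Main.v *)
Require Import Defs.
From mathcomp Require Import all_boot all_order all_algebra.
From mathcomp Require Import all_classical all_reals all_analysis.
From mathcomp Require Import ring lra.
Import Order.TTheory GRing.Theory Num.Theory.
Import numFieldNormedType.Exports.
Set Implicit Arguments. Unset Strict Implicit. Unset Printing Implicit Defensive.
Local Open Scope classical_set_scope.
Local Open Scope ring_scope.

(* With W = W_0, the harmonic function r^lambda_0 w_0 on the cone Omega, one proves
   by bootstrapping in b < 1 that |u| <= N sup|u| W^b on every smaller cylinder.

   One step gains a positive power of the distance to the boundary, which (iii) turns
   into a positive power of W.  The gain comes from an oscillation decay centered at a
   boundary point p: for a positive supercaloric s, any combination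
   a k^(a-1) W + (1-a) k^a s is supercaloric, dominates W^a s^(1-a), and touches it at a
   prescribed point for a suitable k.  So if u <= C W^a on a parabolic cylinder around p
   and s >= 1 on its lateral side and bottom, then u <= C W^a s^(1-a) inside.  Choosing
   s <= 1 - kappa on a concentric smaller cylinder gives a factor (1 - kappa)^(1-a) per
   scale.

   Such an s is 1 minus a multiple of (v - const - const (t0 - t)), where v is the sum
   of the kernels |x - e|^(1-d) over a finite set of points e outside Omega, one in each
   cell of a fine grid that meets the exterior of Omega near p.  The exponent 1-d makes
   the kernel strictly subharmonic in every dimension, while its sums over a grid remain
   bounded independently of the mesh; (ii) bounds the number of points from below.  The
   poles are harmless because u is already small near the boundary of Omega, at a distance
   that is large compared with the mesh. *)

(** * Euclidean norm *)

Section Euclid.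
Variables (R : realType) (d : nat).
Implicit Types x y z : 'rV[R]_d.

Definition sqn x : R := \sum_(i < d) x ord0 i ^+ 2.

Lemma sqn_ge0 x : 0 <= sqn x.
Proof. by apply: sumr_ge0 => i _; apply: sqr_ge0. Qed.

Lemma enorm_ge0 x : 0 <= enorm x.
Proof. exact: sqrtr_ge0. Qed.

Lemma enorm_sqr x : enorm x ^+ 2 = sqn x.
Proof. by rewrite sqr_sqrtr ?sqn_ge0. Qed.

Lemma enorm_eq0 x : (enorm x == 0) = (x == 0).
Proof.
rewrite sqrtr_eq0; apply/idP/eqP => [h|->].
  apply/rowP => i; rewrite mxE; apply/eqP.
  have : x ord0 i ^+ 2 <= 0.
    by apply: le_trans h; rewrite (bigD1 i) //= lerDl sumr_ge0 // => j _; apply: sqr_ge0.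
  by rewrite le_eqVlt ltNge sqr_ge0 orbF sqrf_eq0.
by rewrite big1 // => i _; rewrite mxE expr0n.
Qed.

Lemma enorm_gt0 x : (0 < enorm x) = (x != 0).
Proof. by rewrite lt_neqAle enorm_ge0 andbT eq_sym enorm_eq0. Qed.

Lemma sqn_gt0 x : (0 < sqn x) = (x != 0).
Proof. by rewrite -enorm_sqr exprn_even_gt0 //= enorm_eq0. Qed.

Lemma enorm0 : enorm (0 : 'rV[R]_d) = 0.
Proof. by apply/eqP; rewrite enorm_eq0. Qed.

Lemma sqnZ a x : sqn (a *: x) = a ^+ 2 * sqn x.
Proof. by rewrite /sqn mulr_sumr; apply: eq_bigr => i _; rewrite mxE exprMn. Qed.

Lemma enormZ a x : enorm (a *: x) = `|a| * enorm x.
Proof. by rewrite /enorm -/(sqn _) sqnZ sqrtrM ?sqr_ge0// sqrtr_sqr. Qed.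

Lemma enormN x : enorm (- x) = enorm x.
Proof. by rewrite -scaleN1r enormZ normrN1 mul1r. Qed.

Lemma enormB x y : enorm (x - y) = enorm (y - x).
Proof. by rewrite -enormN opprB. Qed.

Definition dotp x y : R := \sum_(i < d) x ord0 i * y ord0 i.

Lemma sqnD x y : sqn (x + y) = sqn x + 2 * dotp x y + sqn y.
Proof.
rewrite /sqn /dotp mulr_sumr -!big_split /=; apply: eq_bigr => i _.
by rewrite mxE; ring.
Qed.

Lemma dotpZr a x y : dotp x (a *: y) = a * dotp x y.
Proof. by rewrite /dotp mulr_sumr; apply: eq_bigr => i _; rewrite mxE; ring. Qed.

Lemma dotpZl a x y : dotp (a *: x) y = a * dotp x y.
Proof. by rewrite /dotp mulr_sumr; apply: eq_bigr => i _; rewrite mxE; ring. Qed.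

Lemma dotp_le x y : dotp x y <= enorm x * enorm y.
Proof.
have [->|x0] := eqVneq x 0.
  by rewrite enorm0 mul0r /dotp big1 // => i _; rewrite mxE mul0r.
have [->|y0] := eqVneq y 0.
  by rewrite enorm0 mulr0 /dotp big1 // => i _; rewrite mxE mulr0.
have hx : 0 < enorm x by rewrite enorm_gt0.
have hy : 0 < enorm y by rewrite enorm_gt0.
have := sqn_ge0 (enorm y *: x + (- enorm x) *: y).
rewrite sqnD !sqnZ dotpZr dotpZl -!enorm_sqr => h.
have h2 : 0 <= 2 * (enorm x * enorm y) * (enorm x * enorm y - dotp x y).
  by apply: (le_trans h); rewrite le_eqVlt; apply/orP; left; apply/eqP; ring.
by move: h2; rewrite pmulr_rge0 ?mulr_gt0// subr_ge0.
Qed.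

Lemma enormD x y : enorm (x + y) <= enorm x + enorm y.
Proof.
rewrite -(@ler_pXn2r _ 2) ?nnegrE ?addr_ge0 ?enorm_ge0//.
rewrite enorm_sqr sqnD -!enorm_sqr.
have := dotp_le x y; nra.
Qed.

Lemma enorm_triangle x y z : enorm (x - z) <= enorm (x - y) + enorm (y - z).
Proof. by apply: le_trans (enormD _ _); rewrite addrA subrK. Qed.

Lemma coord_le_enorm x i : `|x ord0 i| <= enorm x.
Proof.
rewrite -sqrtr_sqr ler_sqrt ?sqn_ge0// (bigD1 i) //= lerDl.
by apply: sumr_ge0 => j _; apply: sqr_ge0.
Qed.

Lemma norm_le_enorm x : `|x| <= enorm x.
Proof.
rewrite [`|x|]mx_normrE; apply: bigmax_le => [|[i j] _]; first exact: enorm_ge0.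
by rewrite (ord1 i) coord_le_enorm.
Qed.

Lemma enorm_le_norm x : enorm x <= d%:R * `|x|.
Proof.
rewrite -(@ler_pXn2r _ 2) ?nnegrE ?mulr_ge0 ?enorm_ge0//.
rewrite enorm_sqr; apply: (@le_trans _ _ (\sum_(i < d) `|x| ^+ 2)).
  apply: ler_sum => i _; rewrite -real_normK ?num_real// ler_pXn2r ?nnegrE//.
  rewrite [leRHS]mx_normrE; exact: (le_bigmax _ (fun ij => `|x ij.1 ij.2|) (ord0, i)).
rewrite sumr_const card_ord exprMn -[leLHS]mulr_natl; apply: ler_wpM2r; first exact: sqr_ge0.
by rewrite -natrX ler_nat; case: (d) => // n; rewrite leq_pmulr.
Qed.

Lemma continuous_sumr (T : topologicalType) (I : Type) (r : seq I) (P : pred I)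
    (f : I -> T -> R) (t : T) :
  (forall i, {for t, continuous (f i)}) ->
  {for t, continuous (fun t => \sum_(i <- r | P i) f i t)}.
Proof.
move=> fc; elim: r => [|i r IH].
  have -> : (fun t => \sum_(i <- [::] | P i) f i t) = cst 0.
    by apply/funext => z; rewrite big_nil.
  exact: cvg_cst.
have -> : (fun t => \sum_(i <- i :: r | P i) f i t) =
    (fun t => if P i then f i t + \sum_(i <- r | P i) f i t
              else \sum_(i <- r | P i) f i t).
  by apply/funext => z; rewrite big_cons.
by case: (P i) => //; apply: continuousD => //; exact: fc.
Qed.

Lemma continuous_sqn : continuous sqn.
Proof.
move=> x; apply: continuous_sumr => i.
apply: (@continuous_comp _ _ _ (fun y : 'rV[R]_d => y ord0 i) (fun a : R => a ^+ 2)).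
  exact: coord_continuous.
exact: exprn_continuous.
Qed.

Lemma continuous_enorm : continuous (@enorm R d).
Proof.
move=> x; apply: (@continuous_comp _ _ _ sqn (@Num.sqrt R)); first exact: continuous_sqn.
exact: sqrt_continuous.
Qed.

(** The library topology on row vectors is that of the sup norm; the two-sided comparison of norms
    lets Euclidean balls generate the same neighbourhoods. *)
Lemma nbhs_enorm x (A : set 'rV[R]_d) :
  nbhs x A <-> exists2 e : R, 0 < e & forall y, enorm (x - y) < e -> A y.
Proof.
split=> [/nbhs_ballP[e /= e0 h]|[e e0 h]].
  exists e => // y xy; apply: h; rewrite -ball_normE /=.
  exact: le_lt_trans (norm_le_enorm _) xy.
have d0 : 0 < d%:R + 1 :> R by rewrite ltr_wpDl.
apply/nbhs_ballP; exists (e / (d%:R + 1)) => /=; first exact: divr_gt0.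
move=> y; rewrite -ball_normE /= => xy; apply: h.
apply: le_lt_trans (enorm_le_norm _) _.
move: xy; rewrite ltr_pdivlMr// => xy.
by apply: le_lt_trans xy; rewrite mulrC ler_wpM2l// lerDl.
Qed.

Lemma enorm_ev (i : 'I_d) : enorm (ev R i) = 1.
Proof.
rewrite /enorm (bigD1 i) //= big1 ?addr0 ?mxE ?eqxx ?expr1n ?sqrtr1//.
by move=> j ji; rewrite mxE eqxx (negbTE ji) expr0n.
Qed.

End Euclid.

(** * Second derivatives along lines *)

Section TwiceDerivable.
Variable R : realType.
Implicit Types (f g : R -> R) (a b x h : R).

Lemma is_derive_quotient f (x c : R) : is_derive x 1 f c ->
  forall e : R, 0 < e -> exists2 D : R, 0 < D &
    forall h : R, h != 0 -> `|h| < D -> `|(f (x + h) - f x) / h - c| < e.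
Proof.
move=> [df <-] e e0.
have /cvgrPdist_lt /(_ e e0) := df.
rewrite /dnbhs nearE => /nbhs_ballP[D /= D0 hD].
exists D => // h h0 hlt; have := hD h; rewrite /ball /= sub0r normrN => /(_ hlt h0).
rewrite /= distrC /GRing.scale /= mulr1 [h + x]addrC.
by rewrite [in X in X -> _]mulrC.
Qed.

Lemma is_derive_ext f g (x a b : R) : is_derive x 1 f a -> f =1 g -> a = b ->
  is_derive x 1 g b.
Proof. by move=> + /funext <- <-. Qed.

(** Laplacians of comparison functions are computed along coordinate lines, so only one-variable
    derivatives at 0 are recorded. The first derivative has to exist near 0 because the maximum test
    applies the mean value theorem. *)
Definition is_der2 f (a b : R) : Prop :=
  exists f1 : R -> R, [/\ \forall h \near (0:R), is_derive (h:R) 1 f (f1 h),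
    f1 0 = a & is_derive (0 : R) 1 f1 b].

Lemma is_der2_is_derive f a b : is_der2 f a b -> is_derive (0:R) 1 f a.
Proof. by move=> [f1 [/nbhs_singleton h <- _]]. Qed.

Lemma is_der2_cst c : is_der2 (cst c) 0 0.
Proof.
exists (cst 0); split=> //; first by near=> h; exact: is_derive_cst.
exact: is_derive_cst.
Unshelve. all: by end_near. Qed.

Lemma is_der2_ext f g a b a' b' : f =1 g -> a = a' -> b = b' ->
  is_der2 f a b -> is_der2 g a' b'.
Proof. by move=> /funext -> -> ->. Qed.

Lemma is_der2D f g a b a' b' : is_der2 f a b -> is_der2 g a' b' ->
  is_der2 (fun h => f h + g h) (a + a') (b + b').
Proof.
move=> [f1 [h1 h2 h3]] [g1 [k1 k2 k3]]; exists (fun h => f1 h + g1 h); split.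
- near=> h.
  have ? : is_derive (h:R) 1 f (f1 h) by near: h.
  have ? : is_derive (h:R) 1 g (g1 h) by near: h.
  exact: is_deriveD.
- by rewrite h2 k2.
- exact: is_deriveD.
Unshelve. all: by end_near. Qed.

Lemma is_der2Z k f a b : is_der2 f a b -> is_der2 (fun h => k * f h) (k * a) (k * b).
Proof.
move=> [f1 [h1 h2 h3]]; exists (fun h => k * f1 h); split.
- near=> h.
  have ? : is_derive (h:R) 1 f (f1 h) by near: h.
  exact: is_deriveZ.
- by rewrite h2.
- exact: is_deriveZ.
Unshelve. all: by end_near. Qed.

Lemma is_der2_sum I (r : seq I) (P : pred I) (f : I -> R -> R) (a b : I -> R) :
  (forall i, P i -> is_der2 (f i) (a i) (b i)) ->
  is_der2 (fun h => \sum_(i <- r | P i) f i h)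
    (\sum_(i <- r | P i) a i) (\sum_(i <- r | P i) b i).
Proof.
move=> H; elim: r => [|i r IH].
  rewrite !big_nil; apply: is_der2_ext (is_der2_cst 0) => // h.
  by rewrite big_nil.
rewrite !big_cons; case: ifPn => Pi.
  by apply: is_der2_ext (is_der2D (H i Pi) IH) => // h; rewrite big_cons Pi.
by apply: is_der2_ext IH => // h; rewrite big_cons (negbTE Pi).
Qed.

Lemma is_der2M f g a b a' b' : is_der2 f a b -> is_der2 g a' b' ->
  is_der2 (fun h => f h * g h) (f 0 * a' + g 0 * a)
    (f 0 * b' + 2 * (a * a') + g 0 * b).
Proof.
move=> df dg; have fa := is_der2_is_derive df; have ga := is_der2_is_derive dg.
move: df dg => [f1 [h1 h2 h3]] [g1 [k1 k2 k3]].
exists (fun h => f h * g1 h + g h * f1 h); split.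
- near=> h.
  have ? : is_derive (h:R) 1 f (f1 h) by near: h.
  have ? : is_derive (h:R) 1 g (g1 h) by near: h.
  exact: is_deriveM.
- by rewrite h2 k2.
- apply: (is_derive_eq (is_deriveD (is_deriveM fa k3) (is_deriveM ga h3))).
  by rewrite /GRing.scale /= h2 k2; ring.
Unshelve. all: by end_near. Qed.

Lemma is_derive_powRcomp f (h a s : R) : 0 < f h -> is_derive (h:R) 1 f a ->
  is_derive (h:R) 1 (fun t => f t `^ s) (s * f h `^ (s - 1) * a).
Proof.
move=> fp df; exact: (is_derive1_comp (is_derive1_powR s fp) df).
Qed.

Lemma is_der2_powR f a b s : 0 < f 0 -> is_der2 f a b ->
  is_der2 (fun h => f h `^ s) (s * f 0 `^ (s - 1) * a)
    (s * f 0 `^ (s - 1) * b + s * (s - 1) * f 0 `^ (s - 2) * a ^+ 2).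
Proof.
move=> f0 df; have fa := is_der2_is_derive df.
have [f1 [h1 h2 h3]] := df.
have cf : {for 0, continuous f}.
  by apply: differentiable_continuous; apply/derivable1_diffP; case: fa.
have fpos : \forall h \near (0:R), 0 < f h by exact: (cvgr_gt _ cf).
exists (fun h => s * f h `^ (s - 1) * f1 h); split.
- near=> h.
  have ? : is_derive (h:R) 1 f (f1 h) by near: h.
  apply: is_derive_powRcomp => //; near: h; exact: fpos.
- by rewrite h2.
- have := is_deriveM (is_deriveZ s (is_derive_powRcomp (s-1) f0 fa)) h3.
  move=> H; apply: is_derive_ext H _ _ => //; rewrite /GRing.scale /= h2.
  have -> : s - 1 - 1 = s - 2 by ring.
  by rewrite expr2 /GRing.scale /=; ring.
Unshelve. all: by end_near. Qed.

Lemma is_der2_quad a b c : is_der2 (fun h => a + b * h + c * h ^+ 2) b (2 * c).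
Proof.
have did : forall h : R, is_derive (h:R) 1 (fun h : R => h) 1 by move=> h; exact: is_derive_id.
exists (fun h => b + 2 * c * h); split.
- near=> h.
  have H1 := is_deriveD (is_derive_cst a h 1) (is_deriveZ b (did h)).
  have H2 := is_deriveD H1 (is_deriveZ c (is_deriveX 2 (did h))).
  apply: is_derive_ext H2 _ _ => //.
  by rewrite /GRing.scale /=; ring.
- by rewrite mulr0 addr0.
- have H1 := is_deriveD (is_derive_cst b (0:R) 1) (is_deriveZ (2 * c) (did 0)).
  by apply: is_derive_ext H1 _ _ => //; rewrite /GRing.scale /=; ring.
Unshelve. all: by end_near. Qed.

(** Maximality is asked from the left only: at the top of a time cylinder just the past is
    available. *)
Lemma is_derive_left_max f a :
  is_derive (0:R) 1 f a -> (\forall h \near (0:R), h <= 0 -> f h <= f 0) -> 0 <= a.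
Proof.
move=> /is_derive_quotient H /nbhs_ballP[e /= e0 He].
rewrite leNgt; apply/negP => a0.
have na0 : 0 < - a by rewrite oppr_gt0.
have [D D0 HD] := H _ na0.
pose h := - (Num.min e D / 2).
have m0 : 0 < Num.min e D by rewrite lt_min e0.
have h0 : h < 0 by rewrite /h oppr_lt0 divr_gt0.
have hm : `|h| < Num.min e D.
  by rewrite normrN gtr0_norm ?divr_gt0// ltr_pdivrMr// mulr_natr mulr2n ltrDl.
have [he hD] : `|h| < e /\ `|h| < D by apply/andP; rewrite -lt_min.
have := HD h (ltr0_neq0 h0) hD; rewrite add0r ltr_norml => /andP[_].
rewrite ltrBlDr addNr ltr_ndivrMr// mul0r subr_gt0 ltNge He//; last exact: ltW.
by rewrite /ball /= sub0r normrN.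
Qed.

Lemma is_derive_max f a :
  is_derive (0:R) 1 f a -> (\forall h \near (0:R), f h <= f 0) -> a = 0.
Proof.
move=> df m; apply/eqP; rewrite eq_le; apply/andP; split; last first.
  by apply: is_derive_left_max df _; apply: filterS m.
have dg : is_derive (0:R) 1 (f \o -%R) (- a).
  rewrite -[- a]mulrN1; apply: is_derive1_comp.
  by rewrite oppr0.
rewrite -oppr_ge0; apply: is_derive_left_max dg _.
move: m => /nbhs_ballP[e /= e0 He]; apply/nbhs_ballP; exists e => //= h hh _.
rewrite /= oppr0; apply: He; move: hh; rewrite /ball /= !sub0r !normrN; exact.
Qed.

(** If b were positive, the first derivative, which vanishes at 0, would be positive just to the
    right of 0, and the mean value theorem would put f above f 0 there. *)
Lemma is_der2_max f a b : is_der2 f a b -> (\forall h \near (0:R), f h <= f 0) -> b <= 0.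
Proof.
move=> df m; have fa := is_der2_is_derive df.
move: df => [f1 [h1 h2 h3]].
have a0 := is_derive_max fa m.
rewrite leNgt; apply/negP => b0.
have [D D0 HD] := is_derive_quotient h3 b0.
have f1pos h : 0 < h -> h < D -> 0 < f1 h.
  move=> h0 hD; have := HD h (lt0r_neq0 h0); rewrite gtr0_norm// => /(_ hD).
  rewrite add0r h2 a0 subr0 ltr_norml => /andP[+ _].
  by rewrite ltrBrDr addrC subrr pmulr_lgt0// invr_gt0.
move: m h1 => /nbhs_ballP[e1 /= e10 He1] /nbhs_ballP[e2 /= e20 He2].
pose h := Num.min D (Num.min e1 e2) / 2.
have m0 : 0 < Num.min D (Num.min e1 e2) by rewrite !lt_min D0 e10.
have h0 : 0 < h by rewrite /h divr_gt0.
have hm : h < Num.min D (Num.min e1 e2).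
  by rewrite ltr_pdivrMr// mulr_natr mulr2n ltrDl.
have [hD he1 he2] : [/\ h < D, h < e1 & h < e2].
  by move: hm; rewrite !lt_min => /and3P[].
have inb t : 0 <= t -> t <= h -> is_derive (t:R) 1 f (f1 t).
  move=> t0 th; apply: He2; rewrite /ball /= sub0r normrN ger0_norm//.
  exact: le_lt_trans he2.
have [t||c] := @MVT _ f f1 0 h h0.
- by rewrite in_itv/= => /andP[/ltW ? /ltW ?]; exact: inb.
- apply: derivable_within_continuous => t; rewrite in_itv/= => /andP[t0 th].
  by have [] := inb t t0 th.
rewrite in_itv/= subr0 => /andP[c0 ch] fh.
have : 0 < f1 c * h by rewrite mulr_gt0// f1pos// (lt_trans ch).
rewrite -fh subr_gt0 ltNge He1//.
by rewrite /ball /= sub0r normrN gtr0_norm.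
Qed.

Lemma is_derive_line (W : normedModType R) (G : W -> R) (x v : W) (h : R) :
  derivable G (x + h *: v) v ->
  is_derive h 1 (fun t : R => G (x + t *: v)) ('D_v G (x + h *: v)).
Proof.
move=> dG.
have E : (fun k : R => k^-1 *: ((G \o shift (x + h *: v)) (k *: v) - G (x + h *: v))) =
  (fun k : R => k^-1 *: (((fun t : R => G (x + t *: v)) \o shift h) (k *: 1) - G (x + h *: v))).
  apply/funext => k /=; congr (_ *: (G _ - _)).
  have -> : k *: (1 : R^o) + h = k + h by rewrite /GRing.scale /= mulr1.
  by rewrite scalerDl addrCA.
by split; [rewrite /derivable -E | rewrite /derive -E].
Qed.

Lemma is_der2_scale k f a b : is_der2 f a b ->
  is_der2 (fun h => f (k * h)) (k * a) (k ^+ 2 * b).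
Proof.
move=> [f1 [h1 h2 h3]].
have did (h : R) : is_derive h 1 (fun h => k * h) k.
  by apply: is_derive_ext (is_deriveZ k (is_derive_id h 1)) _ _ => //; rewrite /GRing.scale/= mulr1.
have ck : (fun h => k * h) @ (0:R) --> (0:R).
  by rewrite -[X in _ --> X](mulr0 k); apply: cvgM; [exact: cvg_cst|exact: cvg_id].
exists (fun h => k * f1 (k * h)); split.
- near=> h.
  have dh : is_derive (k * h : R) 1 f (f1 (k * h)).
    by near: h; exact: (ck _ h1).
  have := is_derive1_comp dh (did h); rewrite mulrC; exact.
- by rewrite mulr0 h2.
- have h3' : is_derive (k * 0 : R) 1 f1 b by rewrite mulr0.
  have := is_deriveZ k (is_derive1_comp h3' (did 0)).
  by move=> H; apply: is_derive_ext H _ _ => //; rewrite /GRing.scale/=; ring.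
Unshelve. all: by end_near. Qed.

Lemma is_der2_line (W : normedModType R) (D : set W) (F : W -> R) (x v : W) :
  open D -> D x -> smooth_on D F ->
  is_der2 (fun h => F (x + h *: v)) ('D_v F x) ('D_v ('D_v F) x).
Proof.
move=> oD Dx sF.
exists (fun h => 'D_v F (x + h *: v)); split.
- have : \forall h \near (0:R), D (x + h *: v).
    have c0 : (fun h : R => x + h *: v) @ (0:R) --> x + 0 *: v.
      by apply: cvgD; [exact: cvg_cst | apply: cvgZr_tmp; exact: cvg_id].
    apply: c0; rewrite scale0r addr0; exact: open_nbhs_nbhs.
  by apply: filterS => h Dh; apply: is_derive_line; have [+ _] := sF [::] _ Dh; exact.
- by rewrite scale0r addr0.
- have := @is_derive_line W ('D_v F) x v 0; rewrite scale0r addr0; apply.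
  by have [+ _] := sF [:: v] _ Dx; exact.
Qed.

End TwiceDerivable.

(** * Linearity of the directional derivative in its direction *)

Section SmoothLinear.
Variables (R : realType) (W : normedModType R) (D : set W) (F : W -> R).
Hypotheses (oD : open D) (sF : smooth_on D F).

Lemma smooth_derivable x v : D x -> derivable F x v.
Proof. by move=> Dx; have [+ _] := sF [::] Dx; exact. Qed.

Lemma smooth_continuous x : D x -> {for x, continuous F}.
Proof. by move=> Dx; have [_] := sF [::] Dx. Qed.

Lemma deriveZ_dir x (a : R) v : D x -> 'D_(a *: v) F x = a * 'D_v F x.
Proof.
move=> Dx.
have h0 : derivable F (x + 0 *: v) v by rewrite scale0r addr0; exact: smooth_derivable.
have h1 : derivable F (x + 0 *: (a *: v)) (a *: v) by rewrite scale0r addr0; exact: smooth_derivable.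
have da (h : R) : is_derive h 1 (fun h => a * h) a.
  by apply: is_derive_ext (is_deriveZ a (is_derive_id h 1)) _ _ => //; rewrite /GRing.scale/= mulr1.
have d1 := is_derive_line h1.
have h0' : derivable F (x + (a * 0) *: v) v by rewrite mulr0.
have d0 := is_derive1_comp (is_derive_line h0') (da 0).
have E : (fun t : R => F (x + t *: (a *: v))) = (fun t : R => F (x + t *: v)) \o (fun h => a * h).
  by apply/funext => t /=; rewrite scalerA mulrC.
move: d1 d0; rewrite E mulr0 !scale0r addr0 => d1 d0.
by rewrite -(@derive_val _ _ _ _ _ _ _ d1) (@derive_val _ _ _ _ _ _ _ d0) mulrC.
Qed.

(** [smooth_on] speaks of directional derivatives, not of a differential, so additivity is derived:
    the increment along v + w is split at x + h v, and the mean value theorem turns the second piece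
    into a value of ['D_w F] near x. *)
Lemma deriveD_dir x v w : D x -> 'D_(v + w) F x = 'D_v F x + 'D_w F x.
Proof.
move=> Dx; apply/eqP; rewrite -subr_eq0 -normr_eq0 eq_le normr_ge0 andbT.
apply/ler_addgt0Pl => e e0; rewrite addr0.
have e3 : 0 < e / 3 by rewrite divr_gt0.
have [_ cw] := sF [:: w] Dx.
have : \forall y \near x, D y /\ `|'D_w F x - 'D_w F y| < e / 3.
  near=> y; split; first by near: y; exact: open_nbhs_nbhs.
  by near: y; move/cvgrPdist_lt : cw; apply.
move=> /nbhs_ballP[eta /= eta0 Heta].
have isd u : is_derive (0 : R) 1 (fun t : R => F (x + t *: u)) ('D_u F x).
  have := @is_derive_line R W F x u 0; rewrite scale0r addr0; apply.
  exact: smooth_derivable.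
have [d1 d10 H1] := is_derive_quotient (isd (v + w)) e3.
have [d2 d20 H2] := is_derive_quotient (isd v) e3.
pose K := `|v| + `|w| + 1.
have K0 : 0 < K by rewrite ltr_wpDl// addr_ge0.
have [h [h0 hd1 hd2 he]] : exists h : R, [/\ 0 < h, h < d1, h < d2 & h < eta / K].
  have m0 : 0 < Num.min d1 (Num.min d2 (eta / K)) by rewrite !lt_min d10 d20 divr_gt0.
  exists (Num.min d1 (Num.min d2 (eta / K)) / 2).
  have : Num.min d1 (Num.min d2 (eta / K)) / 2 < Num.min d1 (Num.min d2 (eta / K)).
    by rewrite ltr_pdivrMr// mulr_natr mulr2n ltrDl.
  by rewrite !lt_min => /and3P[-> -> ->]; split => //; exact: divr_gt0.
have inD (t : R) : 0 <= t -> t <= h -> ball x eta (x + h *: v + t *: w).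
  move=> t0 th; rewrite -ball_normE /= -addrA opprD addrA subrr sub0r normrN.
  apply: le_lt_trans (ler_normD _ _) _; rewrite !normrZ !ger0_norm//; last exact: ltW.
  move: he; rewrite ltr_pdivlMr// => he; apply: le_lt_trans he.
  rewrite /K !mulrDr; have := ler_wpM2r (normr_ge0 w) th; lra.
have isw (t : R) : 0 <= t -> t <= h ->
    is_derive t 1 (fun t : R => F (x + h *: v + t *: w)) ('D_w F (x + h *: v + t *: w)).
  move=> t0 th; apply: is_derive_line; apply: smooth_derivable.
  by have [] := Heta _ (inD t t0 th).
have [t||c] := @MVT _ (fun t : R => F (x + h *: v + t *: w)) (fun t => 'D_w F (x + h *: v + t *: w)) 0 h h0.
- by rewrite in_itv/= => /andP[/ltW ? /ltW ?]; exact: isw.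
- apply: derivable_within_continuous => t; rewrite in_itv/= => /andP[t0 th].
  by have [] := isw t t0 th.
rewrite in_itv/= subr0 scale0r addr0 => /andP[/ltW c0 /ltW ch] Fh.
have [_ Hc] := Heta _ (inD c c0 ch).
have hn : h != 0 by exact: lt0r_neq0.
have := H1 h hn; rewrite gtr0_norm// => /(_ hd1).
have := H2 h hn; rewrite gtr0_norm// => /(_ hd2).
rewrite !add0r !scale0r !addr0 scalerDr addrA => Hv Hvw.
set A := 'D_(v + w) F x; set B := 'D_v F x; set C := 'D_w F x.
(* The error is made of two difference-quotient errors and the oscillation of ['D_w F], each below e
   / 3. *)
have -> : A - (B + C) = - ((F (x + h *: v + h *: w) - F x) / h - A)
   + ((F (x + h *: v) - F x) / h - B) - (C - 'D_w F (x + h *: v + c *: w)).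
  rewrite -[F (x + h *: v + h *: w)](subrK (F (x + h *: v))) Fh.
  by field.
apply: le_trans (ler_normB _ _) _; apply: le_trans (lerD (ler_normD _ _) (lexx _)) _.
rewrite normrN; move: Hv Hvw Hc; rewrite -/A -/B -/C; lra.
Unshelve. all: by end_near. Qed.

Lemma derive_sum_dir x I (r : seq I) (a : I -> R) (v : I -> W) : D x ->
  'D_(\sum_(i <- r) a i *: v i) F x = \sum_(i <- r) a i * 'D_(v i) F x.
Proof.
move=> Dx; elim: r => [|i r IH]; last by rewrite !big_cons deriveD_dir// deriveZ_dir// IH.
by rewrite !big_nil -(scale0r 0) deriveZ_dir// mul0r.
Qed.

End SmoothLinear.

(** * The harmonic function of the cone *)

Section Cone.
Variables (R : realType) (d : nat).
Implicit Types (x y p : 'rV[R]_d) (M : set 'rV[R]_d) (a : R).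

Lemma rprojZ a x : 0 < a -> rproj (a *: x) = rproj x.
Proof.
move=> a0; rewrite /rproj enormZ gtr0_norm// scalerA invfM.
by rewrite mulrAC mulVf ?mul1r// gt_eqF.
Qed.

Lemma enorm_rproj x : x != 0 -> enorm (rproj x) = 1.
Proof.
move=> x0; rewrite /rproj enormZ ger0_norm ?invr_ge0 ?enorm_ge0//.
by rewrite mulVf// enorm_eq0.
Qed.

Lemma rprojK x : x != 0 -> x = enorm x *: rproj x.
Proof. by move=> x0; rewrite /rproj scalerA mulfV ?enorm_eq0// scale1r. Qed.

Lemma rproj_id x : enorm x = 1 -> rproj x = x.
Proof. by move=> x1; rewrite /rproj x1 invr1 scale1r. Qed.

Lemma rproj_neq0 x : x != 0 -> rproj x != 0.
Proof. by move=> x0; rewrite -enorm_gt0 enorm_rproj. Qed.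

Lemma continuous_rproj x : x != 0 -> {for x, continuous (@rproj R d)}.
Proof.
move=> x0; apply: (@cvgZ _ _ _ (nbhs x) _ (fun y : 'rV[R]_d => (enorm y)^-1) (fun y => y)).
  apply: (@cvgV _ _ (nbhs x)); first by rewrite enorm_eq0.
  exact: continuous_enorm.
exact: cvg_id.
Qed.

Lemma cone_open M : (exists U : set 'rV[R]_d, open U /\ M = U `&` @sphere R d) ->
  open (cone M).
Proof.
move=> [U [oU ->]]; rewrite openE => x [x0 [Ux _]].
rewrite /interior; near=> y.
have y0 : y != 0.
  rewrite -enorm_gt0; near: y; apply: (cvgr_gt _ (@continuous_enorm R d x)).
  by rewrite enorm_gt0.
split=> //; split; last exact: enorm_rproj.
near: y; apply: (continuous_rproj x0); exact: open_nbhs_nbhs.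
Unshelve. all: by end_near. Qed.

Lemma closed_sphere : closed (@sphere R d).
Proof.
have -> : @sphere R d = @enorm R d @^-1` [set 1] by [].
apply: closed_comp; last exact: closed_eq.
by move=> x _; exact: continuous_enorm.
Qed.

Lemma sqn_line x (i : 'I_d) (h : R) :
  sqn (x + h *: ev R i) = sqn x + 2 * x ord0 i * h + 1 * h ^+ 2.
Proof.
rewrite sqnD sqnZ -(enorm_sqr (ev R i)) enorm_ev dotpZr.
have -> : dotp x (ev R i) = x ord0 i.
  rewrite /dotp (bigD1 i) //= big1 ?addr0 ?mxE ?eqxx ?mulr1//.
  by move=> j ji; rewrite mxE eqxx (negbTE ji) mulr0.
by ring.
Qed.

(** Powers of [sqn] stand for |x|^(2s): along a line [sqn] is a quadratic polynomial, to which the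
    power rule applies. *)
Lemma is_der2_sqn_powR x (i : 'I_d) (s : R) : x != 0 ->
  is_der2 (fun h => sqn (x + h *: ev R i) `^ s)
   (s * sqn x `^ (s - 1) * (2 * x ord0 i))
   (s * sqn x `^ (s - 1) * 2 + 4 * s * (s - 1) * sqn x `^ (s - 2) * x ord0 i ^+ 2).
Proof.
move=> x0.
have E h : sqn x + 2 * x ord0 i * h + 1 * h ^+ 2 = sqn (x + h *: ev R i).
  by rewrite sqn_line.
have F0 : 0 < (fun h => sqn x + 2 * x ord0 i * h + 1 * h ^+ 2) 0.
  by rewrite E scale0r addr0 sqn_gt0.
have := is_der2_powR s F0 (is_der2_quad (sqn x) (2 * x ord0 i) 1).
apply: is_der2_ext => [h||]; rewrite E// scale0r addr0// exprMn; ring.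
Qed.

(** The classical Laplacian of |x|^(2s). *)
Lemma lap_sqn_powR x (s : R) : x != 0 ->
  \sum_(i < d) (s * sqn x `^ (s - 1) * 2 + 4 * s * (s - 1) * sqn x `^ (s - 2) * x ord0 i ^+ 2)
  = 2 * s * (d%:R + 2 * s - 2) * sqn x `^ (s - 1).
Proof.
move=> x0; rewrite big_split /= sumr_const card_ord -mulr_sumr -/(sqn x).
have -> : sqn x `^ (s - 1) = sqn x `^ (s - 2) * sqn x.
  have N0 : sqn x != 0 by rewrite gt_eqF// sqn_gt0.
  rewrite -{3}(powRr1 (sqn_ge0 x)) -powRD ?N0 ?implybT//.
  by congr (_ `^ _); ring.
by rewrite -mulr_natr; ring.
Qed.

Lemma leb_outer_ge0 (A : set 'rV[R]_d) : (0 <= leb_outer A)%E.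
Proof.
apply: le_ereal_inf_tmp => _ [ab _ <-]; apply: nneseries_ge0 => k _ _.
by rewrite lee_fin; apply: prodr_ge0 => i _; rewrite le_max lexx orbT.
Qed.

Lemma surf_int_ge0 (E : set 'rV[R]_d) g : (0 <= surf_int E g)%E.
Proof.
by apply: integral_ge0 => s _; apply: mule_ge0; rewrite ?lee_fin ?leb_outer_ge0.
Qed.

Lemma Lambda0_ge0 M : 0 <= Lambda0 M.
Proof.
rewrite /Lambda0; set S := [set _ | _ in _].
(* By convention [inf] of the empty set is 0, so the bound survives the absence of test
   functions. *)
have [->|/set0P S0] := eqVneq S set0; first by rewrite inf0.
apply: lb_le_inf => // _ [w _ <-].
by apply: divr_ge0; apply: fine_ge0; exact: surf_int_ge0.
Qed.

Lemma lambda0_ge0 M : 0 <= lambda0 M.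
Proof.
rewrite /lambda0 addrC subr_ge0; apply: le_trans (ler_norm _) _.
rewrite -sqrtr_sqr ler_wsqrtr// lerDr; exact: Lambda0_ge0.
Qed.

(** The indicial equation: with this exponent the radial and angular parts of the Laplacian of [W0]
    cancel. *)
Lemma lambda0E M : lambda0 M * (lambda0 M + d%:R - 2) = Lambda0 M.
Proof.
rewrite /lambda0; set c := (d%:R - 2) / 2; set q := Num.sqrt _.
have qq : q ^+ 2 = Lambda0 M + c ^+ 2.
  by rewrite sqr_sqrtr// addr_ge0 ?Lambda0_ge0 ?sqr_ge0.
have -> : (- c + q) * (- c + q + d%:R - 2) = q ^+ 2 - c ^+ 2 by rewrite /c; field.
by rewrite qq addrK.
Qed.

Lemma Fext_scale (w : 'rV[R]_d -> R) a x : 0 < a -> Fext w (a *: x) = Fext w x.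
Proof. by move=> a0; rewrite /Fext rprojZ. Qed.

Lemma W0E M w x : W0 M w x = sqn x `^ (lambda0 M / 2) * Fext w x.
Proof.
rewrite /W0 -enorm_sqr -[enorm x ^+ 2]powR_mulrn ?enorm_ge0// -powRrM.
by congr (_ `^ _ * _); field.
Qed.

(** Euler's relation for homogeneity of degree 0: the sum is the derivative in the direction y, and
    [Fext w] is constant along the ray through y. *)
Lemma euler_Fext M w y : open (cone M) -> smooth_on (cone M) (Fext w) ->
  cone M y -> \sum_(i < d) y ord0 i * 'D_(ev R i) (Fext w) y = 0.
Proof.
move=> oM sF My; rewrite -(derive_sum_dir oM sF)//.
have {1}<- : y = \sum_(i < d) y ord0 i *: ev R i by exact: row_sum_delta.
have dF : is_derive (0 : R) 1 (fun t : R => Fext w (y + t *: y)) ('D_y (Fext w) y).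
  have := @is_derive_line R _ (Fext w) y y 0; rewrite scale0r addr0; apply.
  exact: smooth_derivable sF _ _ My.
have d0 : is_derive (0 : R) 1 (fun t : R => Fext w (y + t *: y)) 0.
  have dc := is_derive_cst (Fext w y) (0 : R) 1.
  have n1 : \forall t \near (0 : R^o), `|t| < 1 by exact: nbhs0_lt.
  refine (near_eq_is_derive _ dc); apply: filterS n1 => t.
  rewrite /= -{2}[y]scale1r -scalerDl => t1; rewrite Fext_scale//; move: t1.
  by rewrite ltr_norml => /andP[+ _]; lra.
by rewrite -(@derive_val _ _ _ _ _ _ _ dF) (@derive_val _ _ _ _ _ _ _ d0).
Qed.

(** Product rule for |x|^lambda_0 times [Fext w]: the cross terms vanish by Euler's relation, and
    the radial and angular terms cancel by [lambda0E]. The eigenvalue equation is known on M only,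
    so the derivatives of [Fext w] are pulled back from x to y = x / |x|, each costing a factor 1 /
    r. *)
Lemma W0_harmonic M w x : open (cone M) -> smooth_on (cone M) (Fext w) ->
  (forall y, M y -> lapS w y + Lambda0 M * w y = 0) -> cone M x ->
  exists a b : 'I_d -> R,
    (forall i, is_der2 (fun h => W0 M w (x + h *: ev R i)) (a i) (b i)) /\
    \sum_(i < d) b i = 0.
Proof.
move=> oM sF eqw Mx; have [x0 Mr] := Mx.
set r := enorm x; have r0 : 0 < r by rewrite enorm_gt0.
set y := rproj x; set s := lambda0 M / 2; set N := sqn x.
have N0 : 0 < N by rewrite sqn_gt0.
have My : cone M y.
  by split; [exact: rproj_neq0|rewrite rproj_id// enorm_rproj].
have wy : Fext w y = w y by rewrite /Fext rproj_id// enorm_rproj.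
have dF i : is_der2 (fun h => Fext w (x + h *: ev R i))
    (r^-1 * 'D_(ev R i) (Fext w) y) (r^-1 ^+ 2 * 'D_(ev R i) ('D_(ev R i) (Fext w)) y).
  apply: is_der2_ext (is_der2_scale r^-1 (is_der2_line (ev R i) oM My sF)) => // h.
  rewrite -(Fext_scale w _ r0); congr (Fext w _).
  by rewrite scalerDr -rprojK// scalerA mulrA mulfV ?mul1r// gt_eqF.
have dW i := is_der2M (is_der2_sqn_powR i s x0) (dF i).
exists (fun i => N `^ s * (r^-1 * 'D_(ev R i) (Fext w) y) +
         w y * (s * N `^ (s - 1) * (2 * x ord0 i))).
exists (fun i => N `^ s * (r^-1 ^+ 2 * 'D_(ev R i) ('D_(ev R i) (Fext w)) y) +
         2 * (s * N `^ (s - 1) * (2 * x ord0 i) * (r^-1 * 'D_(ev R i) (Fext w) y)) +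
         w y * (s * N `^ (s - 1) * 2 + 4 * s * (s - 1) * N `^ (s - 2) * x ord0 i ^+ 2)).
split=> [i|].
  by apply: is_der2_ext (dW i) => [h||]; rewrite ?W0E ?scale0r ?addr0.
have Ns : N `^ s = N `^ (s - 1) * r ^+ 2.
  have N1 : N != 0 by rewrite gt_eqF.
  rewrite enorm_sqr -/N -{3}(powRr1 (ltW N0)) -powRD ?N1 ?implybT//.
  by rewrite subrK.
have mid : \sum_(i < d) 2 * (s * N `^ (s - 1) * (2 * x ord0 i) *
    (r^-1 * 'D_(ev R i) (Fext w) y)) = 0.
  transitivity (4 * s * N `^ (s - 1) * \sum_(i < d) y ord0 i * 'D_(ev R i) (Fext w) y).
    rewrite mulr_sumr; apply: eq_bigr => i _; rewrite [y ord0 i]mxE -/r; ring.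
  by rewrite (euler_Fext oM sF My) mulr0.
have lapE : \sum_(i < d) 'D_(ev R i) ('D_(ev R i) (Fext w)) y = - (Lambda0 M * w y).
  by apply/eqP; rewrite -addr_eq0; apply/eqP; exact: eqw.
rewrite !big_split /= mid addr0 -!mulr_sumr lapE (lap_sqn_powR s x0) -/N Ns -lambda0E /s.
by field; rewrite gt_eqF.
Qed.

End Cone.

(** * Measure density of the exterior as a covering count *)

Section Density.
Variables (R : realType) (d : nat).
Hypothesis d0 : (0 < d)%N.
Local Notation V := 'rV[R]_d.

Lemma boxvol_ge0 (a b : V) : 0 <= boxvol a b.
Proof. by apply: prodr_ge0 => i _; rewrite le_max lexx orbT. Qed.

Lemma leb_outer_le_sum (A : set V) (s : seq (V * V)) :
  (forall x, A x -> exists2 ab, ab \in s & box ab.1 ab.2 x) ->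
  (leb_outer A <= (\sum_(ab <- s) boxvol ab.1 ab.2)%:E)%E.
Proof.
move=> As.
(* Padding that turns a finite family into a sequence: the corners are reversed, so the volume is 0
   as soon as d > 0. *)
pose e : V * V := (const_mx 1, 0).
have ve : boxvol e.1 e.2 = 0.
  rewrite /boxvol (bigD1 (Ordinal d0)) //= !mxE [Num.max _ _]max_r ?mul0r//; lra.
apply: ge_ereal_inf; exists (\sum_(0 <= k <oo) (boxvol (nth e s k).1 (nth e s k).2)%:E)%E.
  exists (fun k => (nth e s k).1, fun k => (nth e s k).2) => // x /As[ab sab abx].
  exists (index ab s) => //=; by rewrite nth_index.
rewrite (nneseries_split 0 (size s)); last by move=> k _; rewrite lee_fin boxvol_ge0.
rewrite [X in (_ + X)%E]eseries0 ?adde0; last first.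
  by move=> k; rewrite add0n => sk _; rewrite nth_default// ve.
by rewrite add0n sumEFin (big_nth e).
Qed.

Lemma box_scale (t : R) (a b x : V) : 0 <= t -> box a b x -> box (t *: a) (t *: b) (t *: x).
Proof. by move=> t0 H i; rewrite !mxE; case/andP: (H i) => ? ?; rewrite !ler_wpM2l. Qed.

Lemma boxvol_cube (a : V) (h t : R) : 0 <= h -> 0 <= t ->
  boxvol (t *: a) (t *: (a + const_mx h)) = (t * h) ^+ d.
Proof.
move=> h0 t0; rewrite /boxvol (eq_bigr (fun=> t * h)) ?prodr_const ?card_ord// => i _.
rewrite !mxE mulrDr addrAC subrr add0r max_l//.
exact: mulr_ge0.
Qed.

Lemma sumr_seq_const (T : Type) (s : seq T) (x : R) : \sum_(a <- s) x = (size s)%:R * x.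
Proof.
elim: s => [|a s IH]; first by rewrite big_nil mul0r.
by rewrite big_cons IH [size (_ :: _)]/= -natr1; ring.
Qed.

Lemma expr_le_self (x : R) : 0 <= x -> x <= 1 -> x ^+ d <= x.
Proof. by move=> x0 x1; rewrite -[leRHS]expr1; exact: ler_wiXn2l. Qed.

Lemma dyadic_shell (q x : R) K : 0 <= q -> x < 1 ->
  x < q ^+ K \/ exists2 k, (k < K)%N & q ^+ k.+1 <= x < q ^+ k.
Proof.
move=> q0 x1; elim: K => [|K [xK|[k kK H]]]; first by left.
  have [|xK'] := ltP x (q ^+ K.+1); first by left.
  by right; exists K => //; rewrite xK' xK.
by right; exists k => //; exact: ltn_trans kK _.
Qed.

Lemma geometric_le (q : R) K : 0 <= q -> q < 1 -> \sum_(0 <= k < K) q ^+ k <= (1 - q)^-1.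
Proof.
move=> q0 q1; rewrite -[leRHS]mul1r ler_pdivlMr ?subr_gt0//.
have -> : (\sum_(0 <= k < K) q ^+ k) * (1 - q) = 1 - q ^+ K.
  elim: K => [|K IH]; first by rewrite big_nil mul0r expr0 subrr.
  by rewrite big_nat_recr//= mulrDl IH exprS; ring.
by rewrite gerBl exprn_ge0.
Qed.

Lemma expr_small (q e : R) : 0 <= q -> q < 1 -> 0 < e -> exists K, q ^+ K < e.
Proof.
move=> q0 q1 e0.
have : (fun n => q ^+ n) @ \oo --> (0:R) by apply: cvg_expr; rewrite ger0_norm.
move=> /cvgrPdist_lt /(_ e e0) [K _ /(_ K (leqnn K))].
by rewrite /= sub0r normrN ger0_norm ?exprn_ge0// => H; exists K.
Qed.

Variables (M : set V) (sigma : V) (c : R).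
Hypothesis dens : forall r, 0 < r <= 1 -> ((c * r ^+ d.-1)%:E <=
  leb_outer [set x | (0 < enorm x < 1)%R /\
    (@sphere R d (rproj x) /\ ~ M (rproj x) /\ (enorm (rproj x - sigma) < r)%R)])%E.

(* With q = 1 - r, the copies of the slice scaled by q^k, k >= 0, cover the whole sector,
   which costs a factor 1 / (1 - q) = 1 / r in volume. *)
Lemma slice_cover_count (r rho h : R) (s : seq V) :
  0 < r <= 1 -> 0 < rho -> 0 <= h ->
  (forall y, rho * (1 - r) <= enorm y < rho -> y != 0 -> ~ M (rproj y) ->
     enorm (rproj y - sigma) < r ->
     exists2 a, a \in s & box a (a + const_mx h) y) ->
  c * (rho * r) ^+ d <= (size s)%:R * h ^+ d.
Proof.
move=> /andP[r0 r1] rho0 h0 cov.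
pose q := 1 - r; have q0 : 0 <= q by rewrite subr_ge0.
have q1 : q < 1 by rewrite /q; lra.
(* K scaled copies leave at most a ball of radius q^K uncovered; the cube [B] covers it, and its
   volume tends to 0 as K grows. *)
have main K : c * r ^+ d.-1 <= (size s)%:R * (h / rho) ^+ d / r + 2 ^+ d * q ^+ K.
  pose f (k : nat) (a : V) := ((q ^+ k / rho) *: a, (q ^+ k / rho) *: (a + const_mx h)).
  pose B : V * V := (const_mx (- q ^+ K), const_mx (q ^+ K)).
  rewrite -lee_fin; apply: le_trans (dens _) _; first by rewrite r0.
  apply: (le_trans (@leb_outer_le_sum _ (rcons [seq f k a | k <- iota 0 K, a <- s] B) _)).
    move=> x [/andP[x0 x1] [_ [nM xs]]].
    have [xK|[k kK /andP[kx xk]]] := dyadic_shell K q0 x1.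
      exists B; first by rewrite mem_rcons inE eqxx.
      by move=> i; rewrite !mxE -ler_norml (le_trans (coord_le_enorm _ _))// ltW.
    have qk0 : 0 < q ^+ k by exact: lt_trans xk.
    pose y := (rho / q ^+ k) *: x.
    have rq0 : 0 < rho / q ^+ k by rewrite divr_gt0.
    have [||||a sa bx] := cov y.
    - rewrite enormZ gtr0_norm// mulrAC ler_pdivlMr// ltr_pdivrMr//.
      rewrite -mulrA ler_pM2l// ltr_pM2l// xk andbT.
      by rewrite mulrC -exprSr.
    - by rewrite scaler_eq0 negb_or gt_eqF//= -enorm_gt0.
    - by rewrite rprojZ.
    - by rewrite rprojZ.
    exists (f k a).
      rewrite mem_rcons inE; apply/orP; right; apply/allpairsP; exists (k, a).
      by rewrite mem_iota.
    have -> : x = (q ^+ k / rho) *: y.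
      by rewrite scalerA mulrA divfK ?gt_eqF// mulfV ?gt_eqF// scale1r.
    by apply: box_scale bx; rewrite divr_ge0// ltW.
  rewrite lee_fin -cats1 big_cat big_seq1 /= lerD//.
    rewrite big_allpairs_dep /=.
    (* The k-th copy is smaller in volume by q^(kd) <= q^k, so a geometric series bounds the
       total. *)
    rewrite -[leRHS]mulrA; apply: (@le_trans _ _ (\sum_(k <- iota 0 K) (size s)%:R * ((h / rho) ^+ d * q ^+ k))).
      apply: ler_sum => k _.
      rewrite (eq_bigr (fun=> (q ^+ k / rho * h) ^+ d)); last first.
        by move=> a _; rewrite /f /= boxvol_cube// divr_ge0 ?exprn_ge0// ltW.
      rewrite sumr_seq_const ler_wpM2l//.
      have -> : (q ^+ k / rho * h) ^+ d = (h / rho) ^+ d * (q ^+ k) ^+ d.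
        by rewrite -exprMn; congr (_ ^+ _); ring.
      apply: ler_wpM2l; first by rewrite exprn_ge0 ?divr_ge0 ?(ltW rho0).
      apply: expr_le_self; [exact: exprn_ge0|by apply: exprn_ile1 => //; exact: ltW].
    rewrite -mulr_sumr ler_wpM2l// -mulr_sumr ler_wpM2l ?exprn_ge0 ?divr_ge0 ?(ltW rho0)//.
    have := geometric_le K q0 q1; rewrite /index_iota subn0 => /le_trans; apply.
    by rewrite /q opprB addrC subrK.
  rewrite /boxvol (eq_bigr (fun=> 2 * q ^+ K)); last first.
    move=> i _; rewrite !mxE max_l ?opprK; first by ring.
    by rewrite addr_ge0// exprn_ge0.
  rewrite prodr_const card_ord exprMn ler_wpM2l ?exprn_ge0//.
  apply: expr_le_self; [exact: exprn_ge0|by apply: exprn_ile1 => //; exact: ltW].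
have main' : c * r ^+ d.-1 <= (size s)%:R * (h / rho) ^+ d / r.
  apply/ler_addgt0Pl => e e0.
  have [K HK] := expr_small q0 q1 (divr_gt0 e0 (exprn_gt0 d (ltr0n R 2))).
  apply: le_trans (main K) _; rewrite addrC lerD2r mulrC.
  by rewrite -ler_pdivlMr ?exprn_gt0// ltW.
move: main'; rewrite ler_pdivlMr// -mulrA -exprSr prednK// => main'.
rewrite exprMn mulrCA mulrC -ler_pdivlMr ?exprn_gt0//.
by rewrite -mulrA -expr_div_n.
Qed.

Hypothesis sig1 : enorm sigma = 1.

(** If r <= tau, the slice tau - r <= |y| < tau of angular aperture r / tau lies within r + r of tau
    sigma. If tau < r, the sector of aperture 1 in the ball of radius r around the origin lies
    within r + tau of it. *)
Lemma cone_cover_count (tau r h : R) (s : seq V) : 0 < tau -> 0 < r -> 0 <= h ->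
  (forall y, ~ cone M y -> enorm (y - tau *: sigma) <= 2 * r ->
     exists2 a, a \in s & box a (a + const_mx h) y) ->
  c * r ^+ d <= (size s)%:R * h ^+ d.
Proof.
move=> tau0 r0 h0 cov.
have [rt|tr] := leP r tau.
  have -> : r = tau * (r / tau) by rewrite mulrCA mulfV ?mulr1// gt_eqF.
  apply: slice_cover_count => //; first by rewrite divr_gt0//= ler_pdivrMr// mul1r.
  move=> y /andP[y1 y2] y0 nM ys; apply: cov; first by case.
  have yp : 0 < enorm y by rewrite enorm_gt0.
  apply: le_trans (enorm_triangle _ (enorm y *: sigma) _) _.
  rewrite {1}(rprojK y0) -scalerBr -scalerBl !enormZ sig1 mulr1 ger0_norm ?enorm_ge0//.
  rewrite ler0_norm; last by rewrite subr_le0 ltW.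
  have : enorm y * enorm (rproj y - sigma) <= tau * (r / tau).
    by rewrite ler_pM ?enorm_ge0// ltW.
  rewrite mulrBr mulr1 in y1; move: y1.
  have -> : tau * (r / tau) = r by rewrite mulrCA mulfV ?mulr1// gt_eqF.
  lra.
rewrite -[r]mulr1; apply: slice_cover_count => //; first by rewrite ltr01 lexx.
move=> y /andP[_ y2] y0 nM ys; apply: cov; first by case.
apply: le_trans (enormD _ _) _; rewrite enormN enormZ sig1 mulr1 gtr0_norm//; lra.
Qed.

End Density.

(** * Discrete potentials of the exterior *)

Lemma card_ord_diam n (A : {set 'I_n}) L :
  (forall a b, a \in A -> b \in A -> (b <= a + L)%N) -> (#|A| <= L.+1)%N.
Proof.
move=> H; have [->|[a1 a1A]] := set_0Vmem A; first by rewrite cards0.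
case: (@arg_minnP _ a1 (fun a => a \in A) (fun a : 'I_n => a : nat) a1A) => a0 a0A a0m.
rewrite cardE -(size_map (@nat_of_ord n)) -(size_iota a0 L.+1).
apply: uniq_leq_size; first by rewrite (map_inj_uniq (@ord_inj n)) enum_uniq.
move=> c /mapP[b]; rewrite mem_enum => bA ->.
by rewrite mem_iota a0m//= addnS ltnS H.
Qed.

Lemma card_ffun_family (I J : finType) (A : I -> {set J}) (L : nat) (P : {set {ffun I -> J}}) :
  (forall f, f \in P -> forall i, f i \in A i) -> (forall i, (#|A i| <= L)%N) ->
  (#|P| <= L ^ #|I|)%N.
Proof.
move=> PA AL; apply: (@leq_trans #|(family (fun i => mem (A i)) : simpl_pred {ffun I -> J})|).
  by apply: subset_leq_card; apply/fintype.subsetP => f /PA H; apply/familyP.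
rewrite card_family foldrE big_image /=.
by apply: leq_trans (leq_prod (fun i _ => AL i)) _; rewrite prod_nat_const.
Qed.

Section Potential.
Variables (R : realType) (d : nat).
Hypothesis d0 : (0 < d)%N.
Local Notation V := 'rV[R]_d.

Lemma invX_le (a b : R) n : 0 < a -> a <= b -> b ^- n <= a ^- n.
Proof.
move=> a0 ab; have b0 := lt_le_trans a0 ab.
by rewrite lef_pV2 ?posrE ?exprn_gt0//; apply: lerXn2r; rewrite ?nnegrE ?(ltW a0) ?(ltW b0).
Qed.

Section Grid.
Variables (n : nat) (o : V) (h : R).
Hypothesis h0 : 0 < h.
Local Notation I := {ffun 'I_d -> 'I_n}.

Definition corner (f : I) : V := o + \row_i ((f i)%:R * h).

Variables (P : {set I}) (e : I -> V).
Hypothesis eP : forall f, f \in P -> box (corner f) (corner f + const_mx h) (e f).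

(** In each coordinate, a pole within 2^j h of x confines the corner of its cell to an interval of
    length (2^(j+1) + 1) h, which contains at most 2^(j+1) + 2 grid values. *)
Lemma count_cells x j :
  (#|[set f in P | (enorm (x - e f) <= 2 ^+ j * h)%R]| <= (2 ^ j.+1 + 2) ^ d)%N.
Proof.
pose lo (i : 'I_d) := x ord0 i - o ord0 i - 2 ^+ j * h - h.
pose A (i : 'I_d) := finset (fun a : 'I_n => (lo i <= a%:R * h) && (a%:R * h <= lo i + (2 ^+ j.+1 + 1) * h)).
have := @card_ffun_family _ _ A (2 ^ j.+1 + 2)%N [set f in P | (enorm (x - e f) <= 2 ^+ j * h)%R].
rewrite card_ord; apply.
  move=> f; rewrite inE => /andP[fP xf] i; rewrite inE.
  have := coord_le_enorm (x - e f) i; rewrite !mxE => /le_trans /(_ xf).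
  have := eP fP i; rewrite !mxE /lo exprS ler_norml => /andP[? ?] /andP[? ?].
  by apply/andP; split; nra.
move=> i; rewrite addn2; apply: card_ord_diam => a b.
rewrite !inE => /andP[a1 a2] /andP[b1 b2].
rewrite -(ler_nat R) -(ler_pM2r h0) natrD -natr1 natrX mulrDl.
by lra.
Qed.

Definition shell_sum (Q : pred I) x : R :=
  \sum_(f in P | Q f) h ^+ d * enorm (x - e f) ^- d.-1.

(** The shell of radius about 2^j h holds of the order of 2^(jd) poles, each contributing at most
    about h^d (2^j h)^(1-d), so about 2^j h in all. These amounts double from shell to shell and add
    up to a multiple of the outer radius, whatever the mesh. *)
Lemma dyadic_sum x j : (forall f, f \in P -> h <= enorm (x - e f)) ->
  shell_sum (fun f => enorm (x - e f) <= 2 ^+ j * h) x <= 6 ^+ d * 2 ^+ j * h.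
Proof.
move=> hx.
have crude (Q : pred I) i (a : R) : (forall f, f \in P -> Q f ->
     a <= enorm (x - e f) <= 2 ^+ i * h) -> 0 < a ->
   shell_sum Q x <= (2 ^+ i.+1 + 2) ^+ d * (h ^+ d * a ^- d.-1).
  move=> Qa a0; apply: (@le_trans _ _ (\sum_(f in P | Q f) h ^+ d * a ^- d.-1)).
    apply: ler_sum => f /andP[fP Qf]; rewrite ler_pM2l ?exprn_gt0// invX_le//.
    by case/andP: (Qa f fP Qf).
  rewrite sumr_const -[leLHS]mulr_natl ler_wpM2r ?mulr_ge0 ?invr_ge0 ?exprn_ge0 ?(ltW h0) ?(ltW a0)//.
  have -> : (2 ^+ i.+1 + 2) ^+ d = ((2 ^ i.+1 + 2) ^ d)%N%:R :> R.
    by rewrite natrX natrD natrX.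
  rewrite ler_nat; apply: leq_trans (count_cells x i).
  apply: subset_leq_card; apply/fintype.subsetP => f; rewrite !inE => /andP[fP Qf].
  by rewrite fP; case/andP: (Qa f fP Qf).
have hd : forall a : R, a != 0 -> a ^+ d * a ^- d.-1 = a.
  by move=> a a0; rewrite -{1}(prednK d0) exprS mulfK ?expf_neq0.
elim: j => [|j IH].
  apply: le_trans (crude _ 0%N h _ h0) _ => [f fP|].
    by rewrite hx.
  rewrite expr0 mulr1 hd ?gt_eqF// ler_pM2r//.
  by apply: lerXn2r; rewrite ?nnegrE ?expr1; lra.
rewrite /shell_sum (bigID (fun f => enorm (x - e f) <= 2 ^+ j * h)) /=.
have step : 6 ^+ d * 2 ^+ j.+1 * h = 6 ^+ d * 2 ^+ j * h + 6 ^+ d * 2 ^+ j * h.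
  by rewrite exprS; ring.
rewrite step; apply: lerD.
  apply: le_trans IH; rewrite /shell_sum le_eqVlt; apply/orP; left; apply/eqP.
  apply: eq_bigl => f; case: (f \in P) => //=.
  have [H|] := boolP (enorm (x - e f) <= 2 ^+ j * h); last by rewrite andbF.
  by rewrite andbT (le_trans H)// ler_pM2r// ler_weXn2l// ler1n.
have p0 : 0 < 2 ^+ j * h by rewrite mulr_gt0// exprn_gt0.
pose Q := fun f => (enorm (x - e f) <= 2 ^+ j.+1 * h) && ~~ (enorm (x - e f) <= 2 ^+ j * h).
apply: (@le_trans _ _ (shell_sum Q x)).
  rewrite le_eqVlt; apply/orP; left; apply/eqP; apply: eq_bigl => f.
  by rewrite /Q andbA.
apply: le_trans (crude Q j.+1 (2 ^+ j * h) _ p0) _.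
  by move=> f fP /andP[-> ]; rewrite -ltNge => /ltW ->.
have -> : 6 ^+ d * 2 ^+ j * h = (6 * 2 ^+ j) ^+ d * (h ^+ d * (2 ^+ j * h) ^- d.-1).
  have nz : 2 ^+ j * h != 0 by rewrite gt_eqF.
  rewrite -[LHS]mulrA -[in LHS](hd _ nz) mulrA -exprMn mulrA -exprMn.
  by congr (_ ^+ _ / _); ring.
rewrite ler_pM2r; last by rewrite mulr_gt0 ?invr_gt0 ?exprn_gt0.
have : 1 <= 2 ^+ j :> R by rewrite exprn_ege1// ler1n.
by move=> j1; apply: lerXn2r; rewrite ?nnegrE ?exprS; lra.
Qed.

End Grid.

Lemma sqn_powR_enorm (x : V) n : sqn x `^ (- n%:R / 2) = enorm x ^- n.
Proof.
rewrite -enorm_sqr -[enorm x ^+ 2]powR_mulrn ?enorm_ge0// -powRrM.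
rewrite -powR_invn ?enorm_ge0//; congr (_ `^ _).
by rewrite mulrC divfK// pnatr_eq0.
Qed.

Lemma continuous_sqn_powR (q x : V) (s : R) : x != q ->
  {for x, continuous (fun y : V => sqn (y - q) `^ s)}.
Proof.
move=> xq.
apply: (@continuous_comp _ _ _ (fun y : V => sqn (y - q)) (fun a : R => a `^ s)).
  apply: (@continuous_comp _ _ _ (fun y : V => y - q) (@sqn R d)).
    by apply: (@continuousB _ _ _ (fun y : V => y) (fun=> q)); [exact: cvg_id|exact: cst_continuous].
  exact: continuous_sqn.
apply: differentiable_continuous; apply/derivable1_diffP.
by apply: derivable_powR; rewrite in_itv/= andbT sqn_gt0 subr_eq0.
Qed.

(* The poles, one for each cell meeting E, carry mass h^d each; m is the total mass. *)
Lemma exterior_potential (c r : R) (p : V) (E : set V) : 0 < r ->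
  (forall y, E y -> enorm (y - p) <= 2 * r) ->
  (forall (h : R) (s : seq V), 0 <= h ->
     (forall y, E y -> exists2 a, a \in s & box a (a + const_mx h) y) ->
     c * r ^+ d <= (size s)%:R * h ^+ d) ->
  forall D : R, 0 < D -> exists (v : V -> R) (m : R), c * r ^+ d <= m /\
    forall x, (forall q, E q -> D <= enorm (x - q)) -> enorm (x - p) <= 8 * r ->
    [/\ {for x, continuous v}, v x <= 6 ^+ d * (10 * r),
      exists a b : 'I_d -> R, (forall i, is_der2 (fun t => v (x + t *: ev R i)) (a i) (b i)) /\
         d.-1%:R * m * (10 * r) ^- d.+1 <= \sum_(i < d) b i,
      enorm (x - p) = 8 * r -> v x <= m * (6 * r) ^- d.-1 &
      enorm (x - p) <= r -> m * (3 * r) ^- d.-1 <= v x].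
Proof.
move=> r0 Ep count D D0.
(* The mesh h = 10 r / 2^K is at most D, so every pole is at distance at least h from x, as
   [dyadic_sum] asks. Its outer radius 2^K h = 10 r reaches all poles, since 8 r + 2 r = 10 r. *)
have [K HK] : exists K, (1 / 2) ^+ K < D / (10 * r).
  apply: expr_small; [lra|lra|rewrite divr_gt0//; lra].
pose h := 10 * r * (1 / 2) ^+ K.
have h0 : 0 < h by rewrite /h mulr_gt0 ?exprn_gt0//; lra.
have hD : h <= D.
  by rewrite /h mulrC -ler_pdivlMr ?ltW//; lra.
pose n := (2 ^ K)%N.
have nh : 2 ^+ K * h = 10 * r.
  rewrite /h mulrCA -exprMn; have -> : 2 * (1 / 2) = 1 :> R by field.
  by rewrite expr1n mulr1.
(* The grid fills a cube of side 10 r that starts at p - 2 r in each coordinate and thus contains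
   E. *)
pose o : V := p - const_mx (2 * r).
pose I := {ffun 'I_d -> 'I_n}.
pose cell (f : I) := [set y | E y /\ box (corner o h f) (corner o h f + const_mx h) y].
pose P := finset (fun f : I => `[< exists y, cell f y >]).
(* An arbitrary point of E in the cell; the default 0 is never taken for f in [P]. *)
pose e (f : I) := xget 0 (cell f).
have eP f : f \in P -> cell f (e f).
  by rewrite inE => /asboolP H; exact: xgetPex.
pose m := #|P|%:R * h ^+ d.
have cm : c * r ^+ d <= m.
  (* The cells in [P] cover E, which bounds their number from below. *)
  have := count h [seq corner o h f | f <- enum P] (ltW h0); rewrite size_map -cardE.
  apply=> y Ey.
  have y2 i : `|y ord0 i - p ord0 i| <= 2 * r.
    by have := le_trans (coord_le_enorm (y - p) i) (Ep y Ey); rewrite !mxE.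
  pose z i := (y ord0 i - o ord0 i) / h.
  have z0 i : 0 <= z i.
    rewrite divr_ge0 ?(ltW h0)// !mxE; have := y2 i; rewrite ler_norml; lra.
  have zn i : (Num.trunc (z i) < n)%N.
    rewrite truncn_lt_nat// ltr_pdivrMr// natrX nh !mxE.
    have := y2 i; rewrite ler_norml; lra.
  pose f : I := [ffun i => Ordinal (zn i)].
  have yf : box (corner o h f) (corner o h f + const_mx h) y.
    move=> i; rewrite !mxE ffunE /=.
    have := truncn_itv (z0 i); rewrite ler_pdivlMr// ltr_pdivrMr// !mxE -natr1.
    lra.
  exists (corner o h f) => //; apply/map_f; rewrite mem_enum inE.
  by apply/asboolP; exists y.
exists (fun x => \sum_(f in P) h ^+ d * sqn (x - e f) `^ (- d.-1%:R / 2)), m.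
split=> // x xE xp.
have xe f : f \in P -> h <= enorm (x - e f).
  by move=> /eP[Ee _]; exact: le_trans (xE _ Ee).
have ep f : f \in P -> enorm (e f - p) <= 2 * r by move=> /eP[Ee _]; exact: Ep.
have xe10 f : f \in P -> enorm (x - e f) <= 10 * r.
  move=> fP; apply: le_trans (enorm_triangle _ p _) _; rewrite [enorm (p - _)]enormB.
  have := ep f fP; lra.
have xn f : f \in P -> x != e f.
  by move=> fP; rewrite -subr_eq0 -enorm_gt0; exact: lt_le_trans (xe f fP).
have const_bound (a : R) : m * a = \sum_(f in P) h ^+ d * a.
  by rewrite sumr_const -mulr_natl mulrA.
have vE : \sum_(f in P) h ^+ d * sqn (x - e f) `^ (- d.-1%:R / 2) =
    \sum_(f in P) h ^+ d * enorm (x - e f) ^- d.-1.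
  by apply: eq_bigr => f _; rewrite sqn_powR_enorm.
split.
- suff H (f : I) : f \in P ->
      {for x, continuous (fun y : V => h ^+ d * sqn (y - e f) `^ (- d.-1%:R / 2))}.
    have E0 : (fun y : V => \sum_(f in P) h ^+ d * sqn (y - e f) `^ (- d.-1%:R / 2)) =
       (fun y : V => \sum_(f : I) if f \in P then h ^+ d * sqn (y - e f) `^ (- d.-1%:R / 2) else 0).
      by apply/funext => y; rewrite big_mkcond.
    rewrite E0; apply: continuous_sumr => f.
    have [fP|fP] := boolP (f \in P); first exact: H.
    exact: cst_continuous.
  move=> fP; apply: (@continuousM _ _ (fun=> h ^+ d) (fun y : V => sqn (y - e f) `^ (- d.-1%:R / 2))).
    exact: cst_continuous.
  exact/continuous_sqn_powR/xn.
- rewrite vE.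
  have eP' f : f \in P -> box (corner o h f) (corner o h f + const_mx h) (e f).
    by move=> /eP[].
  have := dyadic_sum h0 eP' (x := x) K xe; rewrite -mulrA nh; apply: le_trans.
  rewrite /shell_sum le_eqVlt; apply/orP; left; apply/eqP; apply: eq_bigl => f.
  by case fP : (f \in P) => //=; rewrite xe10.
- pose s : R := - d.-1%:R / 2.
  exists (fun i => \sum_(f in P) h ^+ d * (s * sqn (x - e f) `^ (s - 1) * (2 * (x - e f) ord0 i))).
  exists (fun i => \sum_(f in P) h ^+ d * (s * sqn (x - e f) `^ (s - 1) * 2 +
      4 * s * (s - 1) * sqn (x - e f) `^ (s - 2) * (x - e f) ord0 i ^+ 2)).
  split=> [i|].
    apply: is_der2_sum => f fP; apply: is_der2Z.
    have := is_der2_sqn_powR i s (x := x - e f); rewrite subr_eq0 => /(_ (xn f fP)).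
    by apply: is_der2_ext => // t; rewrite addrAC.
  rewrite exchange_big /= mulrAC mulrC const_bound; apply: ler_sum => f fP.
  rewrite -mulr_sumr ler_pM2l ?exprn_gt0// lap_sqn_powR ?subr_eq0 ?xn//.
  have dE : d%:R = d.-1%:R + 1 :> R by rewrite natr1 prednK.
  have -> : s - 1 = - d.+1%:R / 2 by rewrite /s -[d.+1%:R]natr1 dE; field.
  have -> : 2 * s * (d%:R + 2 * s - 2) = d.-1%:R by rewrite /s dE; field.
  rewrite sqn_powR_enorm ler_wpM2l// invX_le//; last exact: xe10.
  exact: lt_le_trans (xe f fP).
(* Poles lie within 2 r of p, so they are at distance at least 6 r from x here, and at most 3 r in
   the next case. *)
- move=> x8; rewrite vE const_bound; apply: ler_sum => f fP.
  rewrite ler_pM2l ?exprn_gt0// invX_le//; first lra.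
  have := enorm_triangle x (e f) p; have := ep f fP; lra.
- move=> x1; rewrite vE const_bound; apply: ler_sum => f fP.
  rewrite ler_pM2l ?exprn_gt0// invX_le//; first exact: lt_le_trans (xe f fP).
  apply: le_trans (enorm_triangle _ p _) _; rewrite [enorm (p - _)]enormB.
  have := ep f fP; lra.
Qed.

End Potential.

(** * Comparison principle *)

Section Comparison.
Variables (R : realType) (d : nat).
Local Notation V := 'rV[R]_d.
Local Notation PT := (R * 'rV[R]_d)%type.

Definition cylinder (Om : set V) (t0 T rho : R) (p : V) : set PT :=
  [set z | t0 - T <= z.1 <= t0 /\ Om z.2 /\ enorm (z.2 - p) <= rho].

(** A lower bound on the distance to the exterior, stated without an infimum so that an empty
    exterior is harmless. *)
Definition far (Om : set V) (D : R) (x : V) : Prop :=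
  forall q, ~ Om q -> D <= enorm (x - q).

(** Strict supercaloricity at one point, in terms of derivatives along lines through it: exactly
    what the test at a maximum uses. *)
Definition strict_super (l : PT -> R) (z : PT) : Prop :=
  exists (a b : 'I_d -> R) (c : R),
    [/\ forall i, is_der2 (fun h => l (z.1, z.2 + h *: ev R i)) (a i) (b i),
        is_derive (0 : R) 1 (fun h : R => l (z.1 + h, z.2)) c & \sum_(i < d) b i < c].

Lemma compact_cyl (a b rho : R) (p : V) :
  compact [set z : PT | a <= z.1 <= b /\ enorm (z.2 - p) <= rho].
Proof.
have cB : {for _, continuous (fun y : V => y - p)}.
  by move=> y; apply: (@continuousB _ _ _ (fun y : V => y) (fun=> p)); [exact: cvg_id|exact: cst_continuous].
have cS : compact [set x : V | enorm (x - p) <= rho].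
  apply: bounded_closed_compact.
    exists (rho + `|p|); split; first exact: num_real.
    move=> M HM x /= xp; apply: ltW; apply: le_lt_trans HM.
    rewrite -[x](subrK p); apply: le_trans (ler_normD _ _) _.
    by rewrite lerD2r (le_trans (norm_le_enorm _)).
  have -> : [set x : V | enorm (x - p) <= rho] = (fun x : V => enorm (x - p)) @^-1` [set t | t <= rho] by [].
  apply: closed_comp; last exact: closed_le.
  move=> x _; apply: (@continuous_comp _ _ _ (fun y : V => y - p) (@enorm R d)); first exact: cB.
  exact: continuous_enorm.
have := compact_setX (@segment_compact R a b) cS; congr compact.
Qed.

(** Half the radius of a ball inside [Om] also works for nearby centers; compactness makes it
    uniform. *)
Lemma compact_far (B : set PT) (Om : set V) : open Om -> compact B ->
  (forall z, B z -> Om z.2) -> exists2 D : R, 0 < D & forall z, B z -> far Om D z.2.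
Proof.
move=> oOm cB BO.
have := (proj1 (compact_near_coveringP B) cB) R (0:R)^'+ (fun D z => far Om D z.2) _.
case.
  move=> z Bz; have [e e0 He] := proj1 (nbhs_enorm _ _) (open_nbhs_nbhs (conj oOm (BO z Bz))).
  have e20 : 0 < e / 2 by rewrite divr_gt0.
  exists ([set z' : PT | enorm (z.2 - z'.2) < e / 2], [set D : R | D < e / 2]) => /=.
    split; last by apply: nbhs_right_lt.
    have : nbhs z.2 [set y | enorm (z.2 - y) < e / 2] by apply/nbhs_enorm; exists (e / 2).
    exact: (@cvg_snd _ _ (nbhs z.1) (nbhs z.2)).
  move=> [z' D] /= [zz' De] q nq.
  have : e <= enorm (z.2 - q).
    by rewrite leNgt; apply/negP => H; apply: nq; exact: He.
  have := enorm_triangle z.2 z'.2 q; lra.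
move=> D0 /= D0p H.
exists (D0 / 2); first by rewrite divr_gt0.
apply: H => /=; last by rewrite divr_gt0.
by rewrite /ball/= sub0r normrN gtr0_norm ?divr_gt0// ltr_pdivrMr// mulr_natr mulr2n ltrDl.
Qed.

Section Principle.
Variables (Om : set V) (G : set PT) (u : PT -> R) (t0 T rho : R) (p : V).
Local Notation Z := (cylinder Om t0 T rho p).
Hypotheses (oOm : open Om) (oG : open G) (ZG : Z `<=` G) (su : smooth_on G u).
Hypothesis heat : forall z, Z z -> dt u z = lapx u z.
Hypothesis bd : forall t x, t0 - T <= t <= t0 -> closure Om x -> ~ Om x ->
  enorm (x - p) <= rho -> forall eta, 0 < eta -> \forall z \near ((t, x) : PT), Z z -> u z < eta.

(** A limit point cannot lie on the boundary of [Om], where [bd] pushes u below eta; elsewhere u is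
    continuous. *)
Lemma superlevel_compact eta : 0 < eta -> compact [set z | Z z /\ eta <= u z].
Proof.
move=> eta0; set B := [set z | _].
set K := [set z : PT | t0 - T <= z.1 <= t0 /\ enorm (z.2 - p) <= rho].
have cK : compact K by exact: compact_cyl.
have BK : B `<=` K by move=> z [[? [? ?]] _]; split.
apply: (subclosed_compact _ cK BK).
move=> z cz.
have [Kt Kp] : K z.
  have : closed K by apply: compact_closed => //; exact: norm_hausdorff.
  move/closure_id => ->; exact: closure_subset cz.
have cO : closure Om z.2.
  move=> A /(@cvg_snd _ _ (nbhs z.1) (nbhs z.2)) nA.
  have [w [[[_ [? _]] _] Aw]] := cz _ nA.
  by exists w.2.
have Oz : Om z.2.
  apply: contrapT => nO.
  have := bd Kt cO nO Kp eta0; rewrite -surjective_pairing => /cz [w [[Zw uw] /(_ Zw)]].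
  by rewrite ltNge uw.
have Zz : Z z by [].
split => //; rewrite leNgt; apply/negP => uz.
have := smooth_continuous su (ZG Zz) => /cvgr_lt /(_ _ uz) /cz [w [[_ uw]]] /=.
by rewrite ltNge uw.
Qed.

(** D depends on u and eta but not on l, so the barrier, with its mesh, may be chosen after D. Where
    u >= eta the exterior is at least D away, so nothing is asked of l near its poles. If u - l
    exceeded eta, its maximum over the compact set u >= eta would lie off the bottom and the lateral
    side, against strict supercaloricity. *)
Lemma comparison eta : 0 < eta -> exists2 D : R, 0 < D &
  forall D', 0 < D' -> D' <= D -> forall l : PT -> R,
   (forall z, Z z -> far Om D' z.2 ->
     [/\ 0 <= l z, {for z, continuous l}, strict_super l z &
       z.1 = t0 - T \/ enorm (z.2 - p) = rho -> u z <= l z]) ->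
   forall z, Z z -> far Om D' z.2 -> u z <= l z + eta.
Proof.
move=> eta0; set B := [set z | Z z /\ eta <= u z].
have cB := superlevel_compact eta0.
have [D D0 HD] := compact_far oOm cB (fun z Bz => proj1 (proj2 (proj1 Bz))).
exists D => // D' D'0 D'D l Hl z Zz fz; rewrite leNgt; apply/negP => uz.
have fB w : B w -> far Om D' w.2.
  by move=> Bw q /(HD w Bw); exact: le_trans.
have l0 := Hl _ Zz fz.
have Bz : B z by split => //; case: l0; lra.
have cl w : B w -> {for w, continuous (fun w => u w - l w)}.
  move=> Bw; have [Zw _] := Bw; have [_ lc _ _] := Hl w Zw (fB w Bw).
  by apply: continuousB => //; exact: smooth_continuous su _ (ZG Zw).
have [z1 /set_mem z1B z1max] : exists2 c, c \in B & forall t, t \in B -> u t - l t <= u c - l c.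
  apply: compact_EVT_max => //; first by exists z.
  by apply: continuous_in_subspaceT => w /set_mem; exact: cl.
have gz1 : eta < u z1 - l z1.
  have := z1max z (mem_set Bz); lra.
have [Z1 u1] := z1B.
have [l1 _ [a [b [c [Hb Hc bc]]]] lbd] := Hl z1 Z1 (fB _ z1B).
move: (Z1) => [/andP[t1 t1e] [Oz1 pz1]].
have nbd : ~ (z1.1 = t0 - T \/ enorm (z1.2 - p) = rho) by move=> /lbd; lra.
have t1s : t0 - T < z1.1.
  by rewrite lt_neqAle t1 andbT; apply/eqP => E; apply: nbd; left.
have p1s : enorm (z1.2 - p) < rho.
  by rewrite lt_neqAle pz1 andbT; apply/eqP => E; apply: nbd; right.
(* At the maximum u > eta, because l >= 0; nearby points up to time t0 therefore stay in [B]. The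
   maximum may sit at time t0, which leaves only a one-sided test in time. *)
have near1 : \forall w \near z1, w.1 <= t0 -> u w - l w <= u z1 - l z1.
  have n1 : \forall w \near z1, t0 - T < w.1.
    by apply: (cvgr_gt _ (@cvg_fst _ _ (nbhs z1.1) (nbhs z1.2) _)) => //.
  have n2 : \forall w \near z1, Om w.2.
    by apply: (@cvg_snd _ _ (nbhs z1.1) (nbhs z1.2)); exact: open_nbhs_nbhs.
  have n3 : \forall w \near z1, enorm (w.2 - p) < rho.
    have ce : {for z1, continuous (fun w : PT => enorm (w.2 - p))}.
      apply: (@continuous_comp _ _ _ (fun w : PT => w.2 - p) (@enorm R d)); last exact: continuous_enorm.
      apply: (@continuousB _ _ _ (fun w : PT => w.2) (fun=> p)); last exact: cst_continuous.
      exact: (@cvg_snd _ _ (nbhs z1.1) (nbhs z1.2)).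
    exact: (cvgr_lt _ ce).
  have n4 : \forall w \near z1, eta < u w.
    have cu := smooth_continuous su (ZG Z1).
    by apply: (cvgr_gt _ cu); lra.
  near=> w => w0; apply: z1max; apply: mem_set; split.
    split; first by rewrite w0 andbT ltW//; near: w.
    by split; [near: w|apply: ltW; near: w].
  by apply: ltW; near: w.
have G1 := ZG Z1.
have tau_line (v : PT) : (fun h : R => z1 + h *: v) @ (0:R) --> z1.
  rewrite -[X in _ --> X]addr0 -(scale0r v).
  by apply: cvgD; [exact: cvg_cst | apply: cvgZr_tmp; exact: cvg_id].
have lap_le : lapx u z1 <= \sum_(i < d) b i.
  apply: ler_sum => i _.
  have du := is_der2_line ((0, ev R i) : PT) oG G1 su.
  have E h : z1 + h *: ((0, ev R i) : PT) = (z1.1, z1.2 + h *: ev R i).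
    by apply/pair_equal_spec; split => //=; rewrite scaler0 addr0.
  have dg : is_der2 (fun h => u (z1 + h *: ((0, ev R i) : PT)) - l (z1 + h *: ((0, ev R i) : PT)))
     ('D_((0, ev R i) : PT) u z1 - a i) ('D_((0, ev R i) : PT) ('D_((0, ev R i) : PT) u) z1 - b i).
    apply: is_der2_ext (is_der2D du (is_der2Z (-1) (Hb i))) => [h||].
    - by rewrite mulN1r -E.
    - by rewrite mulN1r.
    - by rewrite mulN1r.
  rewrite -subr_le0; apply: is_der2_max dg _.
  rewrite scale0r addr0.
  have NH := tau_line ((0, ev R i) : PT) _ near1.
  refine (@filterS _ (nbhs (0:R)) _ _ _ _ NH) => h /= H; apply: H.
  by rewrite scaler0 addr0.
have time_ge : c <= dt u z1.
  have du : is_derive (0:R) 1 (fun h : R => u (z1 + h *: ((1, 0) : PT))) (dt u z1).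
    have := @is_derive_line R _ u z1 (1, 0) 0; rewrite scale0r addr0; apply.
    exact: smooth_derivable su _ _ G1.
  have E (h : R) : z1 + h *: ((1, 0) : PT) = (z1.1 + h, z1.2).
    by apply/pair_equal_spec; split; rewrite /= ?scaler0 ?addr0// /GRing.scale/= mulr1.
  have dg : is_derive (0:R) 1 (fun h : R => u (z1 + h *: ((1, 0) : PT)) - l (z1 + h *: ((1, 0) : PT)))
      (dt u z1 - c).
    by apply: is_derive_ext (is_deriveB du Hc) _ _ => // h; rewrite -[LHS]/(u (z1 + h *: ((1, 0) : PT)) - l (z1.1 + h, z1.2)) !E.
  rewrite -subr_ge0; apply: is_derive_left_max dg _.
  rewrite scale0r addr0.
  have NH := tau_line ((1, 0) : PT) _ near1.
  refine (@filterS _ (nbhs (0:R)) _ _ _ _ NH) => h /= H h0; apply: H.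
  by rewrite /GRing.scale/= mulr1; lra.
have := heat Z1; lra.
Unshelve. all: by end_near. Qed.

End Principle.
End Comparison.

(** * Decay across one scale *)

Section Young.
Variable R : realType.

(** Both y and 1 lie above the tangent of the exponential at m = a ln y; with weights a and 1 - a
    the linear terms cancel. *)
Lemma powR_bernoulli (y a : R) : 0 < y -> 0 <= a <= 1 -> y `^ a <= 1 + a * (y - 1).
Proof.
move=> y0 /andP[a0 a1]; rewrite /powR gt_eqF//.
set X := ln y; set m := a * X.
have yX : y = expR m * expR (X - m) by rewrite -expRD addrC subrK lnK.
have oX : 1 = expR m * expR (- m) :> R by rewrite -expRD subrr expR0.
have h1 : expR m * (1 + (X - m)) <= y.
  by rewrite yX ler_pM2l ?expR_gt0// expR_ge1Dx.
have h2 : expR m * (1 + - m) <= 1.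
  by rewrite {2}oX ler_pM2l ?expR_gt0// expR_ge1Dx.
have h3 : a * (expR m * (1 + (X - m))) + (1 - a) * (expR m * (1 + - m)) <= a * y + (1 - a) * 1.
  by apply: lerD; apply: ler_wpM2l => //; rewrite subr_ge0.
have h4 : a * (expR m * (1 + (X - m))) + (1 - a) * (expR m * (1 + - m)) = expR m.
  by rewrite /m; ring.
by move: h3; rewrite h4; lra.
Qed.

(* Tangent plane of the concave function (w, s) |-> w^a s^(1-a) at the points w = k s. *)
Lemma geometric_mean_le (w s k a : R) : 0 < w -> 0 < s -> 0 < k -> 0 <= a <= 1 ->
  w `^ a * s `^ (1 - a) <= a * (k `^ a / k) * w + (1 - a) * k `^ a * s.
Proof.
move=> w0 s0 k0 a01.
have ks0 : 0 < k * s by rewrite mulr_gt0.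
pose y := w / (k * s); have y0 : 0 < y by rewrite divr_gt0.
have -> : w = k * s * y by rewrite /y mulrC divfK ?gt_eqF.
rewrite powRM ?(ltW ks0) ?(ltW y0)// powRM ?(ltW k0) ?(ltW s0)//.
have -> : k `^ a * s `^ a * y `^ a * s `^ (1 - a) = k `^ a * s * y `^ a.
  have sE : s = s `^ a * s `^ (1 - a).
    rewrite -powRD; first by rewrite addrC subrK powRr1// ltW.
    by apply/implyP => _; rewrite gt_eqF.
  by rewrite [in RHS]sE; ring.
have -> : a * (k `^ a / k) * (k * s * y) + (1 - a) * k `^ a * s =
    k `^ a * s * (1 + a * (y - 1)) by field; rewrite gt_eqF.
by rewrite ler_pM2l ?mulr_gt0 ?powR_gt0// powR_bernoulli.
Qed.

(** The contact case k = w / s of the tangent plane. *)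
Lemma geometric_mean_eq (w s a : R) : 0 < w -> 0 < s ->
  w `^ a * s `^ (1 - a) = a * ((w / s) `^ a / (w / s)) * w + (1 - a) * (w / s) `^ a * s.
Proof.
move=> w0 s0; have -> : a * ((w / s) `^ a / (w / s)) * w + (1 - a) * (w / s) `^ a * s =
  (w / s) `^ a * s by field; rewrite !gt_eqF.
have k0 : 0 < w / s by rewrite divr_gt0.
have {1}-> : w = (w / s) * s by rewrite divfK ?gt_eqF.
rewrite powRM ?(ltW k0) ?(ltW s0)// -mulrA -powRD.
  by rewrite addrC subrK powRr1// ltW.
by apply/implyP => _; rewrite gt_eqF.
Qed.

End Young.

Section Growth.
Variables (R : realType) (d : nat).
Hypothesis hd : (2 <= d)%N.
Local Notation V := 'rV[R]_d.
Local Notation PT := (R * 'rV[R]_d)%type.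

Definition harmonic_at (W : V -> R) (x : V) : Prop :=
  {for x, continuous W} /\ exists a b : 'I_d -> R,
    (forall i, is_der2 (fun h => W (x + h *: ev R i)) (a i) (b i)) /\ \sum_(i < d) b i = 0.

(* Covering form of: the exterior of [Om] has outer measure at least c r^d in the ball of
   radius 2r around [p]. *)
Definition fat_at (Om : set V) (c : R) (p : V) : Prop :=
  forall (r h : R) (s : seq V), 0 < r -> 0 <= h ->
    (forall y, ~ Om y -> enorm (y - p) <= 2 * r ->
       exists2 a, a \in s & box a (a + const_mx h) y) ->
    c * r ^+ d <= (size s)%:R * h ^+ d.

Variables (Om : set V) (W : V -> R) (c : R).
Hypotheses (oOm : open Om) (Wpos : forall x, Om x -> 0 < W x)
  (Wh : forall x, Om x -> harmonic_at W x) (c0 : 0 < c).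

(** A tangent plane with coefficients A and B, evaluated at w = W and at the supersolution s built
    from the potential v; mu is a level of v and be a speed in time. *)
Definition barrier (A B al mu be t0 : R) (v : V -> R) : PT -> R :=
  fun z => A * W z.2 + B * (1 - al * (v z.2 - mu - be * (t0 - z.1))).

Lemma barrier_continuous A B al mu be t0 v z : Om z.2 -> {for z.2, continuous v} ->
  {for z, continuous (barrier A B al mu be t0 v)}.
Proof.
move=> Oz vc; have [Wc _] := Wh Oz.
have c1 : {for z, continuous (fun z : PT => z.1)} by exact: (@cvg_fst _ _ (nbhs z.1) (nbhs z.2)).
have c2 : {for z, continuous (fun z : PT => z.2)} by exact: (@cvg_snd _ _ (nbhs z.1) (nbhs z.2)).
have cW : {for z, continuous (fun z : PT => W z.2)} by apply: (@continuous_comp _ _ _ (fun z : PT => z.2) W).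
have cv : {for z, continuous (fun z : PT => v z.2)} by apply: (@continuous_comp _ _ _ (fun z : PT => z.2) v).
have ck (k : R) : {for z, continuous (fun=> k : R)} by exact: cst_continuous.
rewrite /barrier; apply: (@continuousD _ _ _ (fun z : PT => A * W z.2)
  (fun z : PT => B * (1 - al * (v z.2 - mu - be * (t0 - z.1))))).
  exact: (@continuousM _ _ (fun=> A) (fun z : PT => W z.2)).
apply: (@continuousM _ _ (fun=> B) (fun z : PT => 1 - al * (v z.2 - mu - be * (t0 - z.1)))) => //.
apply: (@continuousB _ _ _ (fun _ : PT => 1 : R) (fun z : PT => al * (v z.2 - mu - be * (t0 - z.1)))) => //.
apply: (@continuousM _ _ (fun=> al) (fun z : PT => v z.2 - mu - be * (t0 - z.1))) => //.
apply: (@continuousB _ _ _ (fun z : PT => v z.2 - mu) (fun z : PT => be * (t0 - z.1))).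
  exact: (@continuousB _ _ _ (fun z : PT => v z.2) (fun=> mu)).
apply: (@continuousM _ _ (fun=> be) (fun z : PT => t0 - z.1)) => //.
exact: (@continuousB _ _ _ (fun _ : PT => t0) (fun z : PT => z.1)).
Qed.

(** W is harmonic and drops out: the Laplacian is - B al times that of v, and the time derivative is
    - B al be. *)
Lemma barrier_strict A B al mu be t0 v z (va vb : 'I_d -> R) : Om z.2 ->
  0 < B -> 0 < al ->
  (forall i, is_der2 (fun h => v (z.2 + h *: ev R i)) (va i) (vb i)) ->
  be < \sum_(i < d) vb i ->
  strict_super (barrier A B al mu be t0 v) z.
Proof.
move=> Oz B0 al0 Hv be_lt; have [_ [Wa [Wb [HW WS]]]] := Wh Oz.
exists (fun i => A * Wa i + - (B * al) * va i).
exists (fun i => A * Wb i + - (B * al) * vb i).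
exists (- (B * al) * be); split=> [i||].
- pose k := B * (1 + al * mu + al * be * (t0 - z.1)).
  have := is_der2D (is_der2D (is_der2Z A (HW i)) (is_der2Z (- (B * al)) (Hv i))) (is_der2_cst k).
  apply: is_der2_ext => [h||]; rewrite ?addr0// /barrier /cst /k /=; ring.
- have did := is_deriveZ (- (B * al) * be) (is_derive_id (0:R) 1).
  have := is_deriveD (is_derive_cst (barrier A B al mu be t0 v z) (0:R) 1) did.
  move=> H; apply: is_derive_ext H _ _ => [h|].
    rewrite /barrier /cst /= -[LHS]/(A * W z.2 + B * (1 - al * (v z.2 - mu - be * (t0 - z.1))) + - (B * al) * be * h).
    ring.
  by rewrite add0r /GRing.scale/= mulr1.
- rewrite big_split /= -!mulr_sumr WS mulr0 add0r ltr_nM2l//.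
  by rewrite oppr_lt0 mulr_gt0.
Qed.

(** One scale of the oscillation decay. The three constants are independent of p, r, a, C and u,
    which is what permits iteration. *)
Lemma growth : exists Kt th kap : R, [/\ 0 < Kt, 0 < th <= 1 / 8, 0 < kap < 1 &
  forall p t0 r a C (G : set PT) u, fat_at Om c p -> 0 < r -> 0 <= a < 1 -> 0 < C ->
    let Z := cylinder Om t0 (Kt * r ^+ 2) (8 * r) p in
    open G -> Z `<=` G -> smooth_on G u -> (forall z, Z z -> dt u z = lapx u z) ->
    (forall t x, t0 - Kt * r ^+ 2 <= t <= t0 -> closure Om x -> ~ Om x ->
       enorm (x - p) <= 8 * r ->
       forall eta, 0 < eta -> \forall z \near ((t, x) : PT), Z z -> u z < eta) ->
    (forall z, Z z -> u z <= C * W z.2 `^ a) ->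
    forall z, cylinder Om t0 (Kt * (th * r) ^+ 2) (8 * (th * r)) p z ->
      u z <= C * (1 - kap) `^ (1 - a) * W z.2 `^ a].
Proof.
have d0 : (0 < d)%N by exact: ltnW.
have dm0 : (0 < d.-1)%N by rewrite -subn1 subn_gt0.
(* C3 r bounds v from above, c4 r bounds its lateral level mu from below, and b is such that be r^2
   = b mu. *)
pose C3 : R := 6 ^+ d * 10.
have C30 : 0 < C3 by rewrite mulr_gt0 ?exprn_gt0 ?ltr0n.
pose c4 : R := c * 6 ^- d.-1.
have c40 : 0 < c4 by rewrite mulr_gt0 ?invr_gt0 ?exprn_gt0.
pose b : R := d.-1%:R * 6 ^+ d.-1 * 10 ^- d.+1 / 2.
have b0 : 0 < b by rewrite !mulr_gt0 ?invr_gt0 ?exprn_gt0 ?ltr0n.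
(* The cylinder is long enough for be (t0 - t) to outweigh v at the bottom. *)
pose Kt : R := C3 / (b * c4).
have Kt0 : 0 < Kt by rewrite divr_gt0// mulr_gt0.
(* The bound 1 / 8 puts the inner cylinder within r of p, where v >= 2 mu; the other bound keeps be
   (t0 - t) below mu / 2 there. *)
pose th : R := Num.min (1 / 8) (c4 / (2 * C3)).
have th0 : 0 < th by rewrite lt_min divr_gt0//= divr_gt0// mulr_gt0.
have th8 : th <= 1 / 8 by rewrite ge_min lexx.
have thc : th <= c4 / (2 * C3) by rewrite ge_min lexx orbT.
(* The second entry is the remaining gain al mu / 2 with mu replaced by its lower bound c4 r. *)
pose kap : R := Num.min (1 / 2) (c4 / (4 * C3)).
have kap0 : 0 < kap by rewrite lt_min divr_gt0//= divr_gt0// mulr_gt0.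
have kap2 : kap <= 1 / 2 by rewrite ge_min lexx.
have kapc : kap <= c4 / (4 * C3) by rewrite ge_min lexx orbT.
clearbody kap th.
exists Kt, th, kap; split => //; [by rewrite th0|by rewrite kap0; lra|].
move=> p t0 r a C G u fat r0 /andP[a0 a1] C0 Z oG ZG su heat bd uW z.
move=> [/andP[zt zt'] [Oz zp]].
have thr : th * r <= r by rewrite ger_pMl//; lra.
have thr2 : (th * r) ^+ 2 <= th * r ^+ 2.
  by rewrite exprMn ler_pM2r ?exprn_gt0// expr2 ger_pMl//; lra.
have Zz : Z z.
  split; last by split=> //; apply: le_trans zp _; lra.
  rewrite zt' andbT; apply: le_trans zt; rewrite lerB// ler_pM2l//.
  by apply: le_trans thr2 _; rewrite ger_pMl ?exprn_gt0//; lra.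
apply/ler_addgt0Pl => eta eta0; rewrite addrC.
have [D D0 cmp] := comparison oOm oG ZG su heat bd eta0.
(* The comparison only reaches points far from the exterior; lowering D to e includes z. *)
have [e e0 He] := proj1 (nbhs_enorm _ _) (open_nbhs_nbhs (conj oOm Oz)).
have D'0 : 0 < Num.min D e by rewrite lt_min D0.
have fz : far Om (Num.min D e) z.2.
  move=> q nq; rewrite leNgt; apply/negP => H; apply: nq; apply: He.
  by apply: lt_le_trans H _; rewrite ge_min lexx orbT.
have [|h s h0 cov|v [m [cm Hv]]] := exterior_potential d0 (c := c) (p := p)
    (E := [set y | ~ Om y /\ enorm (y - p) <= 2 * r]) r0 _ _ D'0.
- by move=> y [].
- by apply: fat => // y nO yp; exact: cov.
have {}Hv x : far Om (Num.min D e) x -> enorm (x - p) <= 8 * r -> _ :=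
  fun fx => Hv x (fun q Eq => fx q (proj1 Eq)).
(* mu dominates v on the lateral side, be is half the lower bound on the Laplacian of v, which gives
   strictness, and al keeps [sv] above 1 / 2. *)
pose mu := m * (6 * r) ^- d.-1.
pose be := d.-1%:R * m * (10 * r) ^- d.+1 / 2.
pose al := (2 * (C3 * r))^-1.
have m0 : 0 < m by apply: lt_le_trans cm; rewrite mulr_gt0 ?exprn_gt0.
have rd : r ^+ d = r * r ^+ d.-1 by rewrite -exprS prednK.
have muc : c4 * r <= mu.
  rewrite /mu ler_pdivlMr ?exprn_gt0 ?mulr_gt0// exprMn.
  have -> : c4 * r * (6 ^+ d.-1 * r ^+ d.-1) = c * r ^+ d.
    by rewrite /c4 rd; field; rewrite expf_neq0.
  exact: cm.
have mu0 : 0 < mu by apply: lt_le_trans muc; rewrite mulr_gt0.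
have beE : be * r ^+ 2 = b * mu.
  rewrite /be /b /mu !exprMn; have -> : r ^+ d.+1 = r ^+ 2 * r ^+ d.-1.
    by rewrite -exprD addSn add1n prednK.
  by field; rewrite !expf_neq0 ?gt_eqF.
have be0 : 0 < be.
  have : 0 < be * r ^+ 2 by rewrite beE mulr_gt0.
  by rewrite pmulr_lgt0// exprn_gt0.
have beK : be * (Kt * r ^+ 2) = mu * (C3 / c4).
  rewrite mulrCA beE /Kt; field; rewrite !gt_eqF//.
have al0 : 0 < al by rewrite invr_gt0 !mulr_gt0.
have alC : al * (C3 * r) = 1 / 2 by rewrite /al; field; rewrite !gt_eqF.
have N1 : C3 * r <= be * (Kt * r ^+ 2).
  rewrite beK mulrA ler_pdivlMr//; have := ler_wpM2l (ltW C30) muc; lra.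
have N2 : be * (Kt * (th * r) ^+ 2) <= mu / 2.
  have : be * (Kt * (th * r) ^+ 2) <= be * (Kt * (th * r ^+ 2)).
    by apply: (ler_wpM2l (ltW be0)); apply: (ler_wpM2l (ltW Kt0)).
  have -> : be * (Kt * (th * r ^+ 2)) = mu * (C3 / c4) * th by rewrite -beK; ring.
  move=> /le_trans; apply; rewrite -mulrA ler_pM2l//.
  have -> : 2^-1 = C3 / c4 * (c4 / (2 * C3)) by field; rewrite !gt_eqF.
  by rewrite ler_pM2l// divr_gt0.
pose sv (w : PT) := 1 - al * (v w.2 - mu - be * (t0 - w.1)).
have sv_ge w : Z w -> far Om (Num.min D e) w.2 -> 1 / 2 <= sv w.
  move=> [/andP[w1 w2] [_ wp]] /Hv /(_ wp) [_ vC _ _ _].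
  have tw : 0 <= be * (t0 - w.1) by rewrite mulr_ge0 ?(ltW be0)// subr_ge0.
  have : al * (v w.2 - mu - be * (t0 - w.1)) <= al * (C3 * r).
    by rewrite ler_pM2l// /C3; lra.
  by rewrite alC /sv => H; lra.
have sv_bd w : Z w -> far Om (Num.min D e) w.2 ->
    w.1 = t0 - Kt * r ^+ 2 \/ enorm (w.2 - p) = 8 * r -> 1 <= sv w.
  move=> [/andP[w1 w2] [_ wp]] /Hv /(_ wp) [_ vC _ v8 _] wb.
  have tw : 0 <= be * (t0 - w.1) by rewrite mulr_ge0 ?(ltW be0)// subr_ge0.
  suff : v w.2 - mu - be * (t0 - w.1) <= 0.
    by move=> H; rewrite /sv lerBrDr gerDl pmulr_rle0.
  case: wb => [wt|/v8]; last by rewrite -/mu; lra.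
  have -> : t0 - w.1 = Kt * r ^+ 2 by rewrite wt; ring.
  by move: N1 vC; rewrite /C3; lra.
have sz : sv z <= 1 - kap.
  have zr : enorm (z.2 - p) <= r.
    by apply: le_trans zp _; have := ler_wpM2r (ltW r0) th8; lra.
  have z8 : enorm (z.2 - p) <= 8 * r by case: Zz => _ [].
  have [_ _ _ _ /(_ zr) v1] := Hv _ fz z8.
  (* Passing from distance 6 r to 3 r multiplies the kernel by 2^(d-1), which is at least 2 as d >=
     2. *)
  have mu2 : 2 * mu <= m * (3 * r) ^- d.-1.
    have -> : m * (3 * r) ^- d.-1 = 2 ^+ d.-1 * mu.
      have E6 : 6 * r = 2 * (3 * r) by ring.
      by rewrite /mu E6 !exprMn; field; rewrite !expf_neq0 ?gt_eqF.
    by rewrite ler_pM2r// -{1}[2]expr1 ler_weXn2l// ler1n.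
  have tz : be * (t0 - z.1) <= mu / 2.
    by apply: le_trans N2; rewrite ler_pM2l//; lra.
  have : al * (mu / 2) <= al * (v z.2 - mu - be * (t0 - z.1)).
    by rewrite ler_pM2l//; lra.
  have : al * (c4 * r / 2) <= al * (mu / 2) by rewrite ler_pM2l// ler_pM2r.
  have -> : al * (c4 * r / 2) = c4 / (4 * C3) by rewrite /al; field; rewrite !gt_eqF.
  by rewrite /sv => H1 H2; lra.
have sz0 : 0 < sv z by apply: lt_le_trans (sv_ge z Zz fz).
have Wz := Wpos Oz.
(* The tangent plane is made to touch at z, the point to be estimated. *)
pose k := W z.2 / sv z.
have k0 : 0 < k by rewrite divr_gt0.
have a01 : 0 <= a <= 1 by rewrite a0 ltW.
pose A := C * (a * (k `^ a / k)); pose B := C * ((1 - a) * k `^ a).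
have A0 : 0 <= A by rewrite !mulr_ge0 ?powR_ge0 ?invr_ge0 ?(ltW C0) ?(ltW k0).
have B0 : 0 < B by rewrite !mulr_gt0 ?powR_gt0 ?subr_gt0.
pose l := barrier A B al mu be t0 v.
have lE w : l w = C * (a * (k `^ a / k) * W w.2 + (1 - a) * k `^ a * sv w).
  by rewrite /l /barrier /A /B /sv; ring.
have lz : l z = C * (W z.2 `^ a * sv z `^ (1 - a)).
  by rewrite lE -geometric_mean_eq.
apply: le_trans (cmp _ D'0 _ l _ z Zz fz) _; first by rewrite ge_min lexx.
  move=> w Zw fw; have [wt [Ow wp]] := Zw.
  have [vc vC [va [vb [Hvb vb_ge]]] _ _] := Hv _ fw wp.
  have Ww := Wpos Ow; have sw := sv_ge w Zw fw.
  have sw0 : 0 < sv w by apply: lt_le_trans sw.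
  split.
  - by rewrite lE mulr_ge0 ?(ltW C0)// addr_ge0// !mulr_ge0 ?powR_ge0 ?invr_ge0 ?(ltW Ww) ?(ltW k0) ?(ltW sw0)// subr_ge0 ltW.
  - exact: barrier_continuous.
  - apply: barrier_strict Hvb _ => //; apply: lt_le_trans vb_ge.
    have : 0 < be by []. rewrite /be. set X := d.-1%:R * m * _. lra.
  (* On the bottom and the lateral side [sv] >= 1, so the factor [sv]^(1-a) may be inserted for
     free. *)
  - move=> wb; apply: le_trans (uW w Zw) _; rewrite lE ler_pM2l//.
    apply: le_trans (geometric_mean_le Ww sw0 k0 a01).
    rewrite ler_peMr ?powR_ge0// -[leLHS](powRr0 (sv w)).
    by apply: ler_powR; [exact: sv_bd|rewrite subr_ge0 ltW].
rewrite lz lerD2r -!mulrA ler_pM2l// mulrC ler_pM2r ?powR_gt0//.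
apply: ge0_ler_powR => //; rewrite ?nnegrE; [by rewrite subr_ge0 ltW|exact: ltW|exact: le_trans (ltW sz0) sz].
Qed.

End Growth.

Lemma powR_expr (R : realType) (x s : R) n : 0 <= x -> (x ^+ n) `^ s = (x `^ s) ^+ n.
Proof. by move=> x0; rewrite -(powR_mulrn n x0) -(powR_mulrn n (powR_ge0 x s)) powRAC. Qed.

(** * Iteration over shrinking cylinders at a boundary point *)

Section Decay.
Variables (R : realType) (d : nat).
Hypothesis hd : (2 <= d)%N.
Local Notation V := 'rV[R]_d.
Local Notation PT := (R * 'rV[R]_d)%type.
Variables (Om : set V) (W : V -> R) (c : R).
Hypotheses (oOm : open Om) (Wpos : forall x, Om x -> 0 < W x)
  (Wh : forall x, Om x -> harmonic_at W x) (c0 : 0 < c).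

(** As 1 - a >= eps, each application of [growth] gains at least gam = (1 - kap)^eps. The exponent
    delta solves th^delta = gam, which turns gam^k into a power of the distance to p; Gam = 1 / gam
    pays for rounding that distance to a scale. *)
Lemma boundary_decay eps : 0 < eps < 1 -> exists Kt delta Gam : R,
  [/\ 0 < Kt, 0 < delta, 0 < Gam &
  forall p t0 r a C (G : set PT) u, fat_at Om c p -> 0 < r -> 0 <= a <= 1 - eps -> 0 < C ->
    let Z := cylinder Om t0 (Kt * r ^+ 2) (8 * r) p in
    open G -> Z `<=` G -> smooth_on G u -> (forall z, Z z -> dt u z = lapx u z) ->
    (forall t x, t0 - Kt * r ^+ 2 <= t <= t0 -> closure Om x -> ~ Om x ->
       enorm (x - p) <= 8 * r ->
       forall eta, 0 < eta -> \forall z \near ((t, x) : PT), Z z -> u z < eta) ->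
    (forall z, Z z -> u z <= C * W z.2 `^ a) ->
    forall x, Om x -> 0 < enorm (x - p) < 8 * r ->
      u (t0, x) <= C * Gam * (enorm (x - p) / (8 * r)) `^ delta * W x `^ a].
Proof.
move=> /andP[eps0 eps1].
have [Kt [th [kap [Kt0 /andP[th0 th8] /andP[kap0 kap1] grow]]]] := growth hd oOm Wpos Wh c0.
have th1 : th < 1 by lra.
pose gam := (1 - kap) `^ eps.
have gam0 : 0 < gam by rewrite powR_gt0 ?subr_gt0.
have gam1 : gam < 1.
  rewrite -(powRr0 (1 - kap)) /gam /powR gt_eqF ?subr_gt0//.
  by rewrite mul0r ltr_expR nmulr_llt0 // -(ln1 R) ltr_ln ?posrE; lra.
pose delta := ln gam / ln th.
have lth : ln th < 0 by rewrite -(ln1 R) ltr_ln ?posrE.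
have lgam : ln gam < 0 by rewrite -(ln1 R) ltr_ln ?posrE.
have delta0 : 0 < delta by rewrite /delta -mulrNN mulr_gt0 ?oppr_gt0// invr_lt0.
have thd : th `^ delta = gam.
  by rewrite /powR gt_eqF// /delta divfK ?lt_eqF// lnK ?posrE.
exists Kt, delta, gam^-1; split => //; first by rewrite invr_gt0.
move=> p t0 r a C G u fat r0 /andP[a0 a1] C0 Z oG ZG su heat bd uW x Ox /andP[y0 y8].
pose Zr (s : R) := cylinder Om t0 (Kt * s ^+ 2) (8 * s) p.
have Zmono s : 0 <= s <= r -> Zr s `<=` Z.
  move=> /andP[s0 sr] z [/andP[z1 z1'] [Oz zp]]; split.
    rewrite z1' andbT; apply: le_trans z1; rewrite lerB// ler_pM2l//.
    by apply: lerXn2r => //; rewrite nnegrE// ltW.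
  by split => //; apply: le_trans zp _; rewrite ler_pM2l.
have thk k : 0 < th ^+ k * r <= r.
  rewrite mulr_gt0 ?exprn_gt0//= ger_pMl//; apply: exprn_ile1; exact: ltW.
have iter k : forall z, Zr (th ^+ k * r) z -> u z <= C * gam ^+ k * W z.2 `^ a.
  elim: k => [|k IH] z; first by rewrite !expr0 mulr1 mul1r; exact: uW.
  have /andP[rk0 rk1] := thk k.
  have sub : Zr (th ^+ k * r) `<=` Z by apply: Zmono; rewrite rk1 ltW.
  rewrite [th ^+ k.+1]exprS -mulrA => Zz.
  apply: le_trans (grow p t0 (th ^+ k * r) a (C * gam ^+ k) G u fat rk0 _ _ oG _ su _ _ IH z Zz) _.
  - by rewrite a0; lra.
  - by rewrite mulr_gt0 ?exprn_gt0.
  - by move=> w /sub /ZG.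
  - by move=> w /sub /heat.
  - move=> t y /andP[t1 t2] cy ny yp eta eta0.
    apply: filterS (bd t y _ cy ny _ eta eta0) => [w H /sub /H //||].
      rewrite t2 andbT; apply: le_trans t1; rewrite lerB// ler_pM2l//.
      by apply: lerXn2r => //; rewrite nnegrE ltW.
    by apply: le_trans yp _; rewrite ler_pM2l.
  - rewrite ler_wpM2r ?powR_ge0// exprSr mulrA ler_pM2l ?mulr_gt0 ?exprn_gt0//.
    by apply: ger_powR; lra.
set y := enorm (x - p) in y0 y8 *.
pose q := y / (8 * r).
have r80 : 0 < 8 * r by rewrite mulr_gt0.
have q0 : 0 < q by rewrite divr_gt0.
have q1 : q < 1 by rewrite ltr_pdivrMr// mul1r.
(* K only bounds the search for the scale k with th^(k+1) <= q < th^k. *)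
have [K HK] := expr_small (ltW th0) th1 q0.
have [|[k _ /andP[kq qk]]] := dyadic_shell K (ltW th0) q1.
  by move=> /(lt_trans HK); rewrite ltxx.
have Zk : Zr (th ^+ k * r) (t0, x).
  split; last split => //=.
    by rewrite /= lexx andbT gerBl mulr_ge0 ?(ltW Kt0)// sqr_ge0.
  by move: qk => /ltW; rewrite ler_pdivrMr//; rewrite -/y; lra.
apply: le_trans (iter k _ Zk) _ => /=.
rewrite ler_wpM2r ?powR_ge0// -mulrA ler_pM2l// -ler_pdivrMl ?invr_gt0// invrK -exprS.
have -> : gam ^+ k.+1 = (th ^+ k.+1) `^ delta.
  by rewrite -thd powR_expr// ltW.
apply: ge0_ler_powR; rewrite ?nnegrE; [exact: ltW|exact/exprn_ge0/ltW|exact: ltW|exact: kq].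
Qed.

End Decay.

(** * Change of sign of a smooth function *)

Section Negation.
Variables (R : realType) (W : normedModType R).

(** Prepares the passage from a one-sided bound to |u|. Derivatives see a whole neighbourhood, so
    the induction compares germs in the open set G. *)
Lemma iterDirN (G : set W) (u : W -> R) vs : open G -> smooth_on G u ->
  forall x, G x -> iterDir vs (fun z => - u z) x = - iterDir vs u x.
Proof.
move=> oG su; elim: vs => [|v vs IH] x Gx //=.
have E : {near x, (fun z => - iterDir vs u z) =1 iterDir vs (fun z => - u z)}.
  near=> z; rewrite IH//; near: z; exact: open_nbhs_nbhs.
have [dv _] := su vs x Gx.
by rewrite -(@near_eq_derive _ _ _ _ _ x v E) deriveN.
Unshelve. all: by end_near. Qed.

Lemma smooth_onN (G : set W) (u : W -> R) : open G -> smooth_on G u ->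
  smooth_on G (fun z => - u z).
Proof.
move=> oG su vs x Gx.
have E : {near x, (fun z => - iterDir vs u z) =1 iterDir vs (fun z => - u z)}.
  near=> z; rewrite (iterDirN _ oG su)//; near: z; exact: open_nbhs_nbhs.
have [dv cv] := su vs x Gx; split=> [v|].
  by apply: near_eq_derivable E _; apply: derivableN.
have cN : {for x, continuous (fun z => - iterDir vs u z)} by exact: continuousN.
rewrite /prop_for /continuous_at (iterDirN _ oG su)//.
exact: cvg_trans (near_eq_cvg E) cN.
Unshelve. all: by end_near. Qed.

End Negation.

(** * Boundary of the cone *)

Section ConeBoundary.
Variables (R : realType) (d : nat).
Local Notation V := 'rV[R]_d.
Variable (M : set V).
Hypothesis hrelopen : exists U : set V, open U /\ M = U `&` @sphere R d.

Lemma relopen_sub_sphere : M `<=` @sphere R d.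
Proof. by case: hrelopen => U [_ ->] x []. Qed.

Lemma sbdry_sphere p : sbdry M p -> enorm p = 1.
Proof.
move=> [cp _]; have := closure_subset relopen_sub_sphere cp.
by rewrite -(proj1 (closure_id _) (@closed_sphere R d)).
Qed.

Lemma sbdry_notin_cone p (t : R) : sbdry M p -> 0 < t -> ~ cone M (t *: p).
Proof.
move=> bp t0; have p1 := sbdry_sphere bp; move=> [_].
by rewrite rprojZ// rproj_id//; case: bp.
Qed.

Lemma unit_segment_neq0 (a b : V) (t : R) : enorm a = 1 -> enorm b = 1 -> b != - a ->
  0 <= t <= 1 -> (1 - t) *: a + t *: b != 0.
Proof.
move=> a1 b1 ab /andP[t0 t1]; apply/eqP => H.
have E : (1 - t) *: a = - (t *: b) by apply/eqP; rewrite -addr_eq0 H.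
have : enorm ((1 - t) *: a) = enorm (t *: b) by rewrite E enormN.
rewrite !enormZ a1 b1 !mulr1 !ger0_norm ?subr_ge0// => tt.
have th : t = 1 / 2 by lra.
move/eqP: ab; apply; have : (1 / 2 : R) *: (a + b) = 0.
  rewrite -[RHS]H th scalerDr; congr (_ + _); congr (_ *: _); lra.
move=> /eqP; rewrite scaler_eq0 => /orP[/eqP h|]; first by exfalso; lra.
by rewrite addrC addr_eq0 => /eqP.
Qed.

(** The segment from a to b misses the origin, and M is both open and closed in the sphere; hence
    the parameters whose points lie in [cone M] form an open and closed part of [0, 1], which
    contains 0. *)
Lemma connected_step (a b : V) : closed M -> M a -> enorm b = 1 -> b != - a -> M b.
Proof.
move=> cM Ma b1 ab.
have a1 : enorm a = 1 by exact: relopen_sub_sphere.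
pose g (t : R) : V := (1 - t) *: a + t *: b.
have gc : continuous g.
  move=> t; apply: cvgD; apply: cvgZr_tmp; last exact: cvg_id.
  by apply: cvgB; [exact: cvg_cst|exact: cvg_id].
have oN : open (cone (~` M `&` @sphere R d)).
  by apply: cone_open; exists (~` M); split => //; exact: closed_openC.
have sg : `[0, 1]%classic `&` g @^-1` cone M = `[0, 1]%classic.
apply: (@segment_connected R 0 1).
- exists 0; split; first by rewrite /= in_itv/= lexx ler01.
  rewrite /= /g subr0 scale1r scale0r addr0; split.
    by rewrite -enorm_gt0 a1.
  by rewrite rproj_id.
- exists (g @^-1` cone M) => //; apply: open_comp; last exact: cone_open.
  by move=> y _; exact: gc.
- exists (~` (g @^-1` cone (~` M `&` @sphere R d))).
    by apply: open_closedC; apply: open_comp oN => y _; exact: gc.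
  apply/seteqP; split => t [t01 /=].
    by move=> [_ Mt]; split => // -[_ []].
  move=> nN; split => //; split.
    by apply: unit_segment_neq0 => //; move: t01; rewrite /= in_itv.
  apply: contrapT => nM; apply: nN.
  have g0 : g t != 0 by apply: unit_segment_neq0 => //; move: t01; rewrite /= in_itv.
  by split => //; split => //; exact: enorm_rproj.
have : (`[0, 1]%classic `&` g @^-1` cone M) 1.
  by rewrite sg /= in_itv/= lexx ler01.
move=> [_]; rewrite /= /g subrr scale0r scale1r add0r => -[_].
by rewrite rproj_id.
Qed.

(** Without boundary points M would be closed, and [connected_step] would spread it over the sphere.
    The antipode of x is reached in two steps through a third unit vector, available since d >=
    2. *)
Lemma sbdry_nonempty (hd : (2 <= d)%N) : closure M <> @sphere R d ->
  M !=set0 -> sbdry M !=set0.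
Proof.
move=> nd [x Mx]; apply: contrapT => nb.
have cM : closed M.
  move=> y cy; apply: contrapT => ny; apply: nb; exists y; split => //.
have MS := relopen_sub_sphere.
apply: nd; rewrite -(proj1 (closure_id _) cM); apply/seteqP; split => // q q1.
have [qx|] := eqVneq q (- x); last exact: connected_step.
have [i xi] : exists i : 'I_d, ev R i != x /\ ev R i != - x.
  pose i0 : 'I_d := Ordinal (ltnW hd); pose i1 : 'I_d := Ordinal hd.
  have i01 : i1 != i0 by [].
  have e1 : (ev R i1) ord0 i0 = 0 by rewrite mxE.
  have e0 : (ev R i0) ord0 i0 = 1 by rewrite mxE !eqxx.
  have [E|N1] := eqVneq (ev R i0) x.
    exists i1; split; apply/eqP => H; move: e0; rewrite E.
      by rewrite -H e1 => /eqP; rewrite eq_sym oner_eq0.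
    by rewrite -[x]opprK -H mxE e1 oppr0 => /eqP; rewrite eq_sym oner_eq0.
  have [E|N2] := eqVneq (ev R i0) (- x).
    exists i1; split; apply/eqP => H; move: e0; rewrite E.
      by rewrite -H mxE e1 oppr0 => /eqP; rewrite eq_sym oner_eq0.
    by rewrite -H e1 => /eqP; rewrite eq_sym oner_eq0.
  by exists i0.
have [xi1 xi2] := xi.
apply: (@connected_step (ev R i)) => //; last by rewrite qx eqr_opp eq_sym.
by apply: (@connected_step x) => //; exact: enorm_ev.
Qed.

Lemma sdist_gt0 s : sbdry M !=set0 -> M s -> 0 < sdist s (sbdry M).
Proof.
move=> [p0 bp0] Ms.
have s1 : enorm s = 1 by exact: relopen_sub_sphere.
have Cs : cone M s by split; [rewrite -enorm_gt0 s1|rewrite rproj_id].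
have [e e0 He] := proj1 (nbhs_enorm _ _) (open_nbhs_nbhs (conj (cone_open hrelopen) Cs)).
apply: lt_le_trans e0 _; apply: lb_le_inf; first by exists (enorm (s - p0)), p0.
move=> _ [p bp <-]; rewrite leNgt; apply/negP => /He.
by have := sbdry_notin_cone bp ltr01; rewrite scale1r.
Qed.

Lemma sdist_adherent s : sbdry M !=set0 -> 0 < sdist s (sbdry M) ->
  exists2 p, sbdry M p & enorm (s - p) < 2 * sdist s (sbdry M).
Proof.
move=> [p0 bp0] s0.
have hi : has_inf [set enorm (s - p) | p in sbdry M].
  split; first by exists (enorm (s - p0)), p0.
  by exists 0 => _ [p _ <-]; exact: enorm_ge0.
have [_ [p bp <-] H] := inf_adherent s0 hi.
by exists p => //; apply: lt_le_trans H _; rewrite -/(sdist _ _) mulr_natl mulr2n.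
Qed.

Lemma sdist_le2 s : sbdry M !=set0 -> M s -> sdist s (sbdry M) <= 2.
Proof.
move=> [p0 bp0] Ms; apply: (@le_trans _ _ (enorm (s - p0))).
  by apply: ge_inf; [exists 0 => _ [p _ <-]; exact: enorm_ge0|exists p0].
apply: le_trans (enormD _ _) _; rewrite enormN (sbdry_sphere bp0).
by rewrite (relopen_sub_sphere Ms); lra.
Qed.

Hypothesis hd : (2 <= d)%N.

(** [surf] is d times the outer measure of a sector, so the constant of (ii) divided by d enters the
    covering count. *)
Lemma surf_density : (0 < ereal_inf
     [set e | exists (p : 'rV[R]_d) (r : R),
        [/\ sbdry M p, (0 < r <= 1)%R &
          e = ((r ^- d.-1)%:E *
               surf [set s | @sphere R d s /\ ~ M s /\ (enorm (s - p) < r)%R])%E]])%E ->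
  exists2 c : R, 0 < c & forall p, sbdry M p -> forall t : R, 0 < t -> fat_at (cone M) c (t *: p).
Proof.
set S := [set e | _] => S0.
have [k k0 Hk] : exists2 k : R, 0 < k & forall e, S e -> (k%:E <= e)%E.
  case E : (ereal_inf S) => [k| |]; move: S0; rewrite E => // k0.
    by exists k => // e Se; rewrite -E; exact: ereal_inf_lbound.
  (* The infimum is +oo, as for an empty family; any positive constant will do. *)
  exists 1 => // e Se; apply: (@le_trans _ _ +oo%E); first exact: leey.
  by rewrite -E; exact: ereal_inf_lbound.
have d0 : (0 < d)%N by exact: ltnW.
have dR : 0 < d%:R :> R by rewrite ltr0n.
exists (k / d%:R); first exact: divr_gt0.
move=> p bp t t0 r h s r0 h0 cov.
apply: (cone_cover_count d0 _ (sbdry_sphere bp) t0 r0 h0 cov).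
move=> r' /andP[r'0 r'1].
have Sr : S ((r' ^- d.-1)%:E * surf [set s | @sphere R d s /\ ~ M s /\ (enorm (s - p) < r')%R])%E.
  by exists p, r'; split => //; rewrite r'0.
have := Hk _ Sr; rewrite /surf.
set L := leb_outer _.
have L0 : (0 <= L)%E by exact: leb_outer_ge0.
rewrite -/L; move: L0; case: L => [l| |]//= l0; last by rewrite leey.
rewrite -!EFinM !lee_fin => H.
rewrite mulrAC ler_pdivrMr// [l * _]mulrC.
have rp : 0 < r' ^+ d.-1 by rewrite exprn_gt0.
by rewrite -ler_pdivlMr//; move: H; rewrite [X in _ <= X -> _]mulrC.
Qed.

End ConeBoundary.

(** * Bootstrap *)

Section Bootstrap.
Variables (R : realType) (d : nat).
Hypothesis hd : (2 <= d)%N.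
Local Notation V := 'rV[R]_d.
Local Notation PT := (R * 'rV[R]_d)%type.
Variables (M : set V) (w0 : V -> R).
Hypotheses (hrelopen : exists U : set V, open U /\ M = U `&` @sphere R d)
  (bne : sbdry M !=set0)
  (sw0 : smooth_on (cone M) (Fext w0)) (w0pos : forall x, M x -> 0 < w0 x)
  (eqw0 : forall x, M x -> lapS w0 x + Lambda0 M * w0 x = 0).
Local Notation W := (W0 M w0).

Lemma W0_gt0 x : cone M x -> 0 < W x.
Proof. by move=> [x0 Mx]; rewrite mulr_gt0 ?powR_gt0 ?enorm_gt0// w0pos. Qed.

Lemma W0_harmonic_at x : cone M x -> harmonic_at W x.
Proof.
move=> Cx; split; last exact: W0_harmonic (cone_open hrelopen) sw0 eqw0 Cx.
have -> : W = (fun y => sqn (y - 0) `^ (lambda0 M / 2) * Fext w0 y).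
  by apply/funext => y; rewrite W0E subr0.
apply: (@continuousM _ _ (fun y : V => sqn (y - 0) `^ (lambda0 M / 2)) (Fext w0)).
  by apply: continuous_sqn_powR; case: Cx.
exact: smooth_continuous sw0 _ Cx.
Qed.

(** With s the spherical distance, |x| and s / 2 are at most 1, so raising both to the common
    exponent A + lambda_0 only decreases |x|^lambda_0 and (s / 2)^A, and (iii) bounds s^A. *)
Lemma W0_lower (A N : R) : 0 < A -> 0 < N ->
  (forall s, M s -> N^-1 * powR (sdist s (sbdry M)) A <= w0 s) ->
  forall x, cone M x -> enorm x <= 1 ->
    (enorm x * sdist (rproj x) (sbdry M) / 2) `^ (A + lambda0 M) <= N * W x.
Proof.
move=> A0 N0 lw x [x0 Mx] x1; set s := sdist _ _.
have s0 : 0 < s by exact: sdist_gt0.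
have s2 : s <= 2 by exact: sdist_le2.
have L0 := lambda0_ge0 M.
have e0 : 0 < enorm x by rewrite enorm_gt0.
rewrite -mulrA powRM ?(ltW e0)//; last by rewrite divr_ge0// ltW.
have h1 : enorm x `^ (A + lambda0 M) <= enorm x `^ lambda0 M.
  by apply: ger_powR; rewrite ?e0// lerDr ltW.
have h2 : (s / 2) `^ (A + lambda0 M) <= (s / 2) `^ A.
  by apply: ger_powR; rewrite ?lerDl// divr_gt0//= ler_pdivrMr// mul1r.
have h3 : (s / 2) `^ A <= s `^ A.
  by apply: ge0_ler_powR; rewrite ?nnegrE; lra.
have h4 : s `^ A <= N * w0 (rproj x).
  by have := lw _ Mx; rewrite mulrC ler_pdivrMr// mulrC.
rewrite /W0 mulrCA; apply: ler_pM; rewrite ?powR_ge0//.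
exact: le_trans h2 (le_trans h3 h4).
Qed.

Definition caloric_vanishing (u : PT -> R) : Prop :=
  [/\ smooth_upto (Qcyl M 1) u, forall z, Qcyl M 1 z -> dt u z = lapx u z &
   forall (t0 : R) (x0 : V), 0 < t0 <= 1 -> sbdry (cone M) x0 -> enorm x0 < 1 ->
     u @ within (Qcyl M 1) (nbhs ((t0, x0) : PT)) --> (0 : R)].

Lemma caloric_vanishingN u : caloric_vanishing u -> caloric_vanishing (fun z => - u z).
Proof.
move=> [[G [oG [QG su]]] heat lim]; split.
- by exists G; split => //; split => //; exact: smooth_onN.
- move=> z Qz; have Gz := QG _ Qz.
  have E1 : dt (fun z => - u z) z = - dt u z.
    exact: (iterDirN [:: ((1, 0) : PT)] oG su Gz).
  rewrite E1 heat// /lapx -sumrN; apply: eq_bigr => i _; symmetry.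
  exact: (iterDirN [:: ((0, ev R i) : PT); ((0, ev R i) : PT)] oG su Gz).
- move=> t0 x0 t01 bx x1; rewrite -[X in _ --> X]oppr0.
  by apply: cvgN; exact: lim.
Qed.

Lemma Qcyl_sub (R1 R2 : R) : 0 <= R1 <= R2 -> Qcyl M R1 `<=` Qcyl M R2.
Proof.
move=> /andP[R10 R12] z [/andP[z1 z2] [Cz ez]]; split; last first.
  by split => //; exact: lt_le_trans R12.
rewrite z2 andbT; apply: le_lt_trans z1; rewrite lerB//.
by apply: lerXn2r => //; rewrite nnegrE// (le_trans R10).
Qed.

(** Quantified over all radii because every step shrinks the cylinder, and over all real majorants S
    > 0 so that the extended-real supremum appears only at the end. *)
Definition decay_bound (a : R) : Prop := forall R1 : R, 0 < R1 < 1 ->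
  exists2 N : R, 0 < N & forall u, caloric_vanishing u ->
    forall S : R, 0 < S -> (forall z, Qcyl M 1 z -> `|u z| <= S) ->
    forall z, Qcyl M R1 z -> `|u z| <= N * S * W z.2 `^ a.

Lemma decay_bound0 : decay_bound 0.
Proof.
move=> R1 /andP[R10 R11]; exists 1 => // u _ S S0 uS z Qz.
by rewrite powRr0 mul1r mulr1; apply: uS; apply: Qcyl_sub Qz; rewrite !ltW.
Qed.

Variables (c B K : R).
Hypotheses (c0 : 0 < c) (B0 : 0 < B) (K0 : 0 < K)
  (fat : forall p, sbdry M p -> forall t : R, 0 < t -> fat_at (cone M) c (t *: p))
  (low : forall x, cone M x -> enorm x <= 1 ->
     (enorm x * sdist (rproj x) (sbdry M) / 2) `^ B <= K * W x).

(** The decay gains a power del of the distance X to the boundary; by [low], X^B is at most K W, so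
    this is worth a power del / B of W. The gain is the same for all a. *)
Lemma decay_bound_step eps : 0 < eps < 1 -> exists2 tau : R, 0 < tau &
  forall a b, 0 <= a -> a <= 1 - eps -> a <= b -> b <= a + tau -> decay_bound a -> decay_bound b.
Proof.
move=> eps01.
have oC := cone_open hrelopen.
have [Kt [del [Gam [Kt0 del0 Gam0 dec]]]] := boundary_decay hd oC W0_gt0 W0_harmonic_at c0 eps01.
exists (del / B); first exact: divr_gt0.
move=> a b a0 a1 ab bt IH R1 /andP[R10 R11].
(* The bound for a is used on this larger cylinder, which leaves room around boundary points. *)
pose R2 := (1 + R1) / 2.
have R12 : R1 < R2 by rewrite /R2; lra.
have R21 : R2 < 1 by rewrite /R2; lra.
clearbody R2.
have R20 : 0 < R2 < 1 by rewrite R21 andbT (lt_trans R10).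
have [N N0 HN] := IH R2 R20.
(* 8 r fits into the gap between the radii, and Kt r^2 <= Kt r into the gap between the starting
   times. *)
have [r [r0 r8 r1 rK]] : exists r : R, [/\ 0 < r, 8 * r <= R2 - R1, r <= 1 & Kt * r <= R2 ^+ 2 - R1 ^+ 2].
  have q0 : 0 < (R2 ^+ 2 - R1 ^+ 2) / Kt by rewrite divr_gt0// subr_gt0 ltrXn2r// ltW.
  exists (Num.min 1 (Num.min ((R2 - R1) / 8) ((R2 ^+ 2 - R1 ^+ 2) / Kt))); split.
  - by rewrite !lt_min ltr01 q0 divr_gt0// subr_gt0.
  - by rewrite mulrC -ler_pdivlMr// !ge_min lexx !orbT.
  - by rewrite !ge_min lexx.
  - by rewrite mulrC -ler_pdivlMr// !ge_min lexx !orbT.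
pose N' := N * (Gam + 1) * (1 / (2 * r)) `^ del * K `^ (b - a).
exists N'.
  by rewrite !mulr_gt0 ?powR_gt0 ?divr_gt0 ?mulr_gt0//; lra.
suff one u : caloric_vanishing u -> forall S, 0 < S ->
    (forall z, Qcyl M 1 z -> `|u z| <= S) ->
    forall z, Qcyl M R1 z -> u z <= N' * S * W z.2 `^ b.
  move=> u cu S S0 uS z Qz; rewrite ler_norml; apply/andP; split; last exact: one.
  rewrite lerNl; apply: (one _ (caloric_vanishingN cu)) => // w Qw.
  by rewrite normrN; exact: uS.
move=> cu S S0 uS [t0 x] Qz; have [[G [oG [QG su]]] heat lim] := cu.
have [/= /andP[tl t1] [Cx xR]] := Qz.
have [x0 Mx] := Cx.
set rho := enorm x in xR *; have rho0 : 0 < rho by rewrite enorm_gt0.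
have s0 := sdist_gt0 hrelopen bne Mx.
have [p' bp' p's] := sdist_adherent bne s0.
set s := sdist (rproj x) (sbdry M) in s0 p's.
(* The boundary point at the same radius as x, in an almost nearest direction. *)
pose p := rho *: p'.
have enp : enorm p = rho by rewrite enormZ (sbdry_sphere hrelopen bp') mulr1 gtr0_norm.
have yE : enorm (x - p) = rho * enorm (rproj x - p').
  by rewrite {1}(rprojK x0) -scalerBr enormZ gtr0_norm.
have y0 : 0 < enorm (x - p).
  rewrite enorm_gt0 subr_eq0; apply/eqP => E.
  by have := sbdry_notin_cone hrelopen bp' rho0; rewrite -/p -E.
pose X := rho * s / 2.
have X0 : 0 < X by rewrite divr_gt0// mulr_gt0.
have yX : enorm (x - p) < 4 * X.
  have -> : 4 * X = rho * (2 * s) by rewrite /X; field.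
  by rewrite yE ltr_pM2l.
have X1 : X <= 1.
  have s2 := sdist_le2 hrelopen bne Mx; rewrite -/s in s2.
  have : rho * s <= 1 * 2 by apply: ler_pM; rewrite ?(ltW rho0) ?(ltW s0)//; lra.
  by rewrite /X; lra.
have Wx := W0_gt0 Cx.
have NS0 : 0 < N * S by rewrite mulr_gt0.
have uN := HN u cu S S0 uS.
have X2r : 0 < X / (2 * r) by rewrite divr_gt0// mulr_gt0.
have key : u (t0, x) <= N * S * ((Gam + 1) * (X / (2 * r)) `^ del) * W x `^ a.
  (* If |x - p| >= 8 r, then X >= 2 r, so the extra factor is at least 1 and the bound for a
     suffices; the 1 in Gam + 1 serves this case. *)
  have [y8|y8] := ltP (enorm (x - p)) (8 * r); last first.
    have Qz2 : Qcyl M R2 (t0, x) by apply: Qcyl_sub Qz; rewrite !ltW.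
    apply: le_trans (ler_norm _) _; apply: le_trans (uN _ Qz2) _.
    rewrite ler_wpM2r ?powR_ge0// ler_peMr ?(ltW NS0)//.
    have : 1 <= (X / (2 * r)) `^ del.
      rewrite -[leLHS](powRr0 (X / (2 * r))); apply: ler_powR; last exact: ltW.
      by rewrite ler_pdivlMr ?mulr_gt0//; lra.
    by move=> H; rewrite -[leLHS]mulr1; apply: ler_pM => //; lra.
  pose Z := cylinder (cone M) t0 (Kt * r ^+ 2) (8 * r) p.
  have Kr : Kt * r ^+ 2 <= R2 ^+ 2 - R1 ^+ 2.
    by apply: le_trans rK; rewrite ler_pM2l// expr2 ger_pMl.
  have ZQ2 : Z `<=` Qcyl M R2.
    move=> z [/andP[z1 z2] [Cz zp]]; split.
      by apply/andP; split; lra.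
    split => //; have := enormD (z.2 - p) p; rewrite subrK enp.
    by lra.
  have ZQ : Z `<=` Qcyl M 1.
    by move=> z /ZQ2; apply: Qcyl_sub; apply/andP; split; lra.
  have R2s : R2 ^+ 2 < 1 by rewrite expr_lt1//; lra.
  have H := dec p t0 r a (N * S) G u (fat bp' rho0) r0 _ NS0 oG _ su _ _ _ x Cx _.
  apply: le_trans (H _ _ _ _ _ _) _.
  - by rewrite a0.
  - by move=> z /ZQ /QG.
  - by move=> z /ZQ /heat.
  - move=> t y /andP[ty1 ty2] cy ny yp eta eta0.
    have ty : 0 < t <= 1 by apply/andP; split; lra.
    have ey : enorm y < 1.
      by have := enormD (y - p) p; rewrite subrK enp; lra.
    have := lim t y ty (conj cy ny) ey => /cvgr_lt /(_ eta eta0).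
    rewrite /= near_withinE; apply: filterS => z Hz /ZQ; exact: Hz.
  - by move=> z /ZQ2 Qz2; apply: le_trans (ler_norm _) _; exact: uN.
  - by rewrite y0.
  rewrite ler_wpM2r ?powR_ge0// -mulrA ler_pM2l//.
  apply: ler_pM; rewrite ?powR_ge0 ?(ltW Gam0) ?lerDl//.
  apply: ge0_ler_powR; rewrite ?nnegrE; [exact: ltW| | exact: ltW|].
    by rewrite divr_ge0 ?enorm_ge0// mulr_ge0// ltW.
  rewrite ler_pdivrMr ?mulr_gt0//.
  have -> : X / (2 * r) * (8 * r) = 4 * X by field; rewrite gt_eqF.
  exact: ltW.
apply: le_trans key _ => /=.
have X2 : (X / (2 * r)) `^ del = (1 / (2 * r)) `^ del * X `^ del.
  rewrite -powRM ?(ltW X0)//; last by rewrite divr_ge0// mulr_ge0// ltW.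
  by congr (_ `^ _); field; rewrite gt_eqF.
(* X <= 1 and B (b - a) <= del allow lowering the exponent before [low] is applied. *)
have Xd : X `^ del <= K `^ (b - a) * W x `^ (b - a).
  rewrite -powRM ?(ltW K0) ?(ltW Wx)//.
  apply: (@le_trans _ _ ((X `^ B) `^ (b - a))).
    rewrite -powRrM; apply: ger_powR; first by rewrite X0.
    by rewrite mulrC -ler_pdivlMr//; lra.
  apply: ge0_ler_powR; rewrite ?nnegrE ?powR_ge0 ?subr_ge0//.
    by rewrite mulr_ge0// ltW.
  by apply: low => //; rewrite -/rho; lra.
have Wb : W x `^ b = W x `^ (b - a) * W x `^ a.
  rewrite -powRD; first by rewrite subrK.
  by apply/implyP => _; rewrite gt_eqF.
rewrite X2 Wb /N'.
set P := (1 / (2 * r)) `^ del; set Wa := W x `^ a.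
have F0 : 0 <= N * S * ((Gam + 1) * P) * Wa.
  by rewrite !mulr_ge0 ?powR_ge0 ?(ltW N0) ?(ltW S0)// addr_ge0// ltW.
have := ler_wpM2l F0 Xd.
set Y := K `^ (b - a); set Wba := W x `^ (b - a); set Xdel := X `^ del.
by move=> H; apply: le_trans (le_trans _ H) _; rewrite le_eqVlt; apply/orP; left; apply/eqP; ring.
Qed.

(** Finitely many steps of length tau starting from 0; the exponent is capped at 1 - eps to keep the
    step applicable. *)
Lemma decay_bound_all eps : 0 < eps < 1 -> decay_bound (1 - eps).
Proof.
move=> eps01; have [tau tau0 step] := decay_bound_step eps01.
have /andP[eps0 eps1] := eps01.
have H k : decay_bound (Num.min (k%:R * tau) (1 - eps)).
  elim: k => [|k IH].
    rewrite mul0r min_l; first exact: decay_bound0.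
    by rewrite subr_ge0 ltW.
  apply: (step _ _ _ _ _ _ IH).
  - by rewrite le_min mulr_ge0 ?(ltW tau0)// subr_ge0 ltW.
  - by rewrite ge_min lexx orbT.
  - by rewrite le_min !ge_min lexx orbT andbT -natr1 mulrDl mul1r lerDl ltW.
  - rewrite -natr1 mulrDl mul1r minEle [in leRHS]minEle.
    by case: ifP => ?; case: ifP => ?; lra.
have [k Hk] : exists k : nat, 1 - eps <= k%:R * tau.
  exists (Num.trunc ((1 - eps) / tau)).+1.
  by rewrite -ler_pdivrMr// ltW// truncnS_gt.
by have := H k; rewrite min_r.
Qed.

End Bootstrap.

(** * From the bootstrap to the bound by the supremum *)

Theorem theorem5p24 (R : realType) (d : nat) (hd : (2 <= d)%N)
  (M : set 'rV[R]_d) (hMS : M `<=` @sphere R d)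
  (* (i) *)
  (hconn : connected M)
  (hrelopen : exists U : set 'rV[R]_d, open U /\ M = U `&` @sphere R d)
  (hnotdense : closure M <> @sphere R d)
  (* (ii) *)
  (hii : (0 < ereal_inf
            [set e | exists (p : 'rV[R]_d) (r : R),
               [/\ sbdry M p, (0 < r <= 1)%R &
                 e = ((r ^- d.-1)%:E *
                      surf [set s | @sphere R d s /\ ~ M s /\ (enorm (s - p) < r)%R])%E]])%E)
  (w0 : 'rV[R]_d -> R) (hw0 : first_dirichlet_eigenfunction M w0)
  (* (iii) *)
  (hiii : exists A N : R, [/\ 0 < A, 0 < N &
            forall s, M s -> N^-1 * powR (sdist s (sbdry M)) A <= w0 s]) :
  forall eps Rr : R, 0 < eps < 1 -> 0 < Rr < 1 ->
  exists N : R, 0 < N /\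
    forall u : R * 'rV[R]_d -> R,
      smooth_upto (Qcyl M 1) u ->
      (forall z, Qcyl M 1 z -> dt u z = lapx u z) ->
      (forall (t0 : R) (x0 : 'rV[R]_d), 0 < t0 <= 1 ->
          sbdry (cone M) x0 -> enorm x0 < 1 ->
          u @ within (Qcyl M 1) (nbhs ((t0, x0) : R * 'rV[R]_d)) --> (0 : R)) ->
      forall z, Qcyl M Rr z ->
        ((`|u z|)%:E <=
           N%:E * ereal_sup [set (`|u y|)%:E | y in Qcyl M 1]
                * (powR (W0 M w0 z.2) (1 - eps))%:E)%E.
Proof.
have [sw0 [_ [w0pos [_ eqw0]]]] := hw0.
have [A [N0 [A0 N00 low]]] := hiii.
move=> eps r eps01 r01.
have r1 : 0 <= r <= 1 by case/andP: r01 => ? ?; rewrite !ltW.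
(* For empty M the cylinder is empty and any N works. *)
have [->|/set0P Mne] := eqVneq M set0.
  by exists 1; split => // u _ _ _ z [_ [[_ []]]].
have bne := sbdry_nonempty hrelopen hd hnotdense Mne.
have [c c0 fat] := surf_density hrelopen hd hii.
have B0 : 0 < A + lambda0 M by rewrite ltr_wpDr// lambda0_ge0.
have lowW := W0_lower hrelopen bne A0 N00 low.
have [N N1 HN] := decay_bound_all hd hrelopen bne sw0 w0pos eqw0 c0 B0 N00 fat lowW eps01 r01.
exists N; split => // u su heat lim z Qz.
have cu : caloric_vanishing M u by [].
have Qz1 : Qcyl M 1 z by exact: Qcyl_sub Qz.
have Wz : 0 < powR (W0 M w0 z.2) (1 - eps).
  by rewrite powR_gt0// (W0_gt0 w0pos)//; case: Qz => _ [].
set S := ereal_sup _.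
have ub y : Qcyl M 1 y -> ((`|u y|)%:E <= S)%E.
  by move=> Qy; apply: ereal_sup_ubound; exists y.
have S0 : (0 <= S)%E by apply: le_trans (ub z Qz1); rewrite lee_fin.
(* The bootstrap needs a positive finite majorant: a zero supremum forces u z = 0, and an infinite
   one makes the right side +oo since W > 0. *)
case E : S S0 => [s| |]//.
- rewrite lee_fin le_eqVlt => /orP[/eqP s0|s0].
    by have := ub z Qz1; rewrite E -s0 mule0 mul0e.
  rewrite -!EFinM lee_fin; apply: HN => // y /ub.
  by rewrite E lee_fin.
- by move=> _; rewrite gt0_muley ?lte_fin// gt0_mulye ?lte_fin// leey.
Qed.
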